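(* Let $\mathcal{D}$ be a $\Sigma$-free operad in $\mathbf{Cat}$ with associated monad $\mathbb{D}$. Every $\mathbb{D}$-algebra $\mathcal{C}$ has an underlying $\mathbb{D}$-multicategory: the data $U\mathcal{C}$ described in the context satisfy all the requirements of a $\mathbb{D}$-multicategory.
   Context: **Operads and monads.** An operad $\mathcal{D}$ in $\mathbf{Cat}$ (symmetric, with small categories $\mathcal{D}_n$, $n\ge 0$) is $\Sigma$-free if each $\Sigma_n$ acts freely on $\mathcal{D}_n$. Its associated monad on $\mathbf{Cat}$ is $\mathbb{D}\mathcal{C}=\coprod_{n\ge0}\mathcal{D}_n\times_{\Sigma_n}\mathcal{C}^n$. For $k\ge 0$, the $k$-simplices of the nerves of the $\mathcal{D}_n$ form an operad in $\mathbf{Set}$, whose associated monad on $\mathbf{Set}$ is $\mathbb{D}_kX=\coprod_{n\ge0}(N\mathcal{D}_n)_k\times_{\Sigma_n}X^n$. For a small category $\mathcal{C}$, $\mathcal{C}_k$ is the set of $k$-simplices of its nerve ($\mathcal{C}_0$ objects, $\mathcal{C}_1$ morphisms), and $(\mathbb{D}\mathcal{C})_k=\mathbb{D}_k\mathcal{C}_k$. The source, target, identity and composition of the categories $\mathcal{D}_n$ induce maps of monads $S_{\mathbb{D}},T_{\mathbb{D}}:\mathbb{D}_1\to\mathbb{D}_0$, $I_{\mathbb{D}}:\mathbb{D}_0\to\mathbb{D}_1$, $\gamma_{\mathbb{D}}:\mathbb{D}_1\times_{\mathbb{D}_0}\mathbb{D}_1\cong\mathbb{D}_2\to\mathbb{D}_1$.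 Monad multiplications and units are written $\mu,\eta$. Source, target, identity and composition in a category are $S,T,I,\gamma$. $*$ is the terminal set or category; $\varepsilon$ also denotes a terminal map. In a fiber product $X\times_ZY$, the structure map of $X$ is of ''source'' type and that of $Y$ of ''target'' type; e.g. composition is $\gamma:\mathcal{C}_1\times_{\mathcal{C}_0}\mathcal{C}_1\to\mathcal{C}_1$, $(g,f)\mapsto g\circ f$ for $S(g)=T(f)$. **Presheaves.** A presheaf structure on a set $X$ over a small category $\mathcal{C}$ is a map $\varepsilon:X\to\mathcal{C}_0$ and an action $X\times_{\mathcal{C}_0}\mathcal{C}_1\to X$, $(x,f)\mapsto x\cdot f$, defined when $\varepsilon(x)=T(f)$, with $\varepsilon(x\cdot f)=S(f)$, $x\cdot\mathrm{id}=x$, $(x\cdot f)\cdot g=x\cdot(f\circ g)$. A map of presheaves $h:X\to X'$ over a functor $F:\mathcal{C}\to\mathcal{C}'$ ($X$ over $\mathcal{C}$, $X'$ over $\mathcal{C}'$) satisfies $\varepsilon' h=F_0\varepsilon$ and $h(x\cdot f)=h(x)\cdot F(f)$; ''over $\mathcal{C}$'' means over $\mathrm{id}_{\mathcal{C}}$. If $X$ is a presheaf over $\mathcal{C}$ with action $\xi$, then $\mathbb{D}_0X$ is a presheaf over $\mathbb{D}\mathcal{C}$ with structure map $\mathbb{D}_0\varepsilon$ and action $\mathbb{D}_0X\times_{\mathbb{D}_0\mathcal{C}_0}\mathbb{D}_1\mathcal{C}_1\cong\mathbb{D}_1(X\times_{\mathcal{C}_0}\mathcal{C}_1)\xrightarrow{\mathbb{D}_1\xi}\mathbb{D}_1X\xrightarrow{S_{\mathbb{D}}}\mathbb{D}_0X$,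 the isomorphism being inverse to $(T_{\mathbb{D}}\circ\mathbb{D}_1p_1,\mathbb{D}_1p_2)$. Since every set is a presheaf over $*$, for a set $M_0$ the set $\mathbb{D}_0M_0$ is a presheaf over $\mathbb{D}( * )$; if $M_1$ is a presheaf over $\mathbb{D}( * )$ then $\mathbb{D}_0M_1$ is one over $\mathbb{D}^2( * )$. **$\mathbb{D}$-multicategories.** A $\mathbb{D}$-multicategory $M$ consists of: a set $M_0$; a set $M_1$ with a presheaf structure over $\mathbb{D}( * )$; a map $T:M_1\to M_0$ of presheaves over $\mathbb{D}( * )\to *$; a map $S:M_1\to\mathbb{D}_0M_0$ of presheaves over $\mathbb{D}( * )$; a map $I:M_0\to M_1$ of presheaves over the unit $*\to\mathbb{D}( * )$; and a map $\gamma:M_2\to M_1$ of presheaves over $\mu:\mathbb{D}^2( * )\to\mathbb{D}( * )$. Here $M_2=M_1\times_{\mathbb{D}_0M_0}\mathbb{D}_0M_1$ is the pullback of $S:M_1\to\mathbb{D}_0M_0$ and $\mathbb{D}_0T:\mathbb{D}_0M_1\to\mathbb{D}_0M_0$, with projections $T:M_2\to M_1$, $S:M_2\to\mathbb{D}_0M_1$ and $\mathbb{D}^2( * )$-action $(m,n)\cdot\phi=(m\cdot\mathbb{D}\varepsilon(\phi),n\cdot\phi)$, $\varepsilon:\mathbb{D}( * )\to *$. The axioms are: $SI=\eta$, $TI=\mathrm{id}$; $T\gamma=T\circ T$; $S\gamma=\mu\circ\mathbb{D}_0S\circ S$; $\gamma(I(T(m)),\eta(m))=m=\gamma(m,\mathbb{D}_0I(S(m)))$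 for $m\in M_1$; and associativity $\gamma\gamma_T=\gamma\gamma_S:M_3\to M_1$, where $M_3$ is the pullback of $S:M_2\to\mathbb{D}_0M_1$ and $\mathbb{D}_0T:\mathbb{D}_0M_2\to\mathbb{D}_0M_1$ with projections $T:M_3\to M_2$, $S:M_3\to\mathbb{D}_0M_2$, and $\gamma_T=(\gamma\circ T,\ \mu\circ\mathbb{D}_0S\circ S)$, $\gamma_S=(T\circ T,\ \mathbb{D}_0\gamma\circ S)$ as maps to $M_2=M_1\times_{\mathbb{D}_0M_0}\mathbb{D}_0M_1$. **The data $U\mathcal{C}$.** A $\mathbb{D}$-algebra is a small category $\mathcal{C}$ with a (strict) action $\xi:\mathbb{D}\mathcal{C}\to\mathcal{C}$, given by $\xi_0:\mathbb{D}_0\mathcal{C}_0\to\mathcal{C}_0$ and $\xi_1:\mathbb{D}_1\mathcal{C}_1\to\mathcal{C}_1$. $U\mathcal{C}$ has $(U\mathcal{C})_0=\mathcal{C}_0$; $(U\mathcal{C})_1=\mathcal{C}_1\times_{\mathcal{C}_0}\mathbb{D}_0\mathcal{C}_0$, the pullback of $S:\mathcal{C}_1\to\mathcal{C}_0$ and $\xi_0$, with projections $\kappa_1$ to $\mathcal{C}_1$ and $S$ (the source map of $U\mathcal{C}$) to $\mathbb{D}_0\mathcal{C}_0$; target $T\circ\kappa_1$; identity $I_{U\mathcal{C}}=(I_{\mathcal{C}},\eta)$; composition $\gamma_{U\mathcal{C}}=(\gamma_{\mathcal{C}}\circ\kappa_2,\ \mu\circ\mathbb{D}_0S\circ S)$,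 where $\kappa_2=(\kappa_1\circ T,\ \xi_1\circ I_{\mathbb{D}}\circ\mathbb{D}_0\kappa_1\circ S):(U\mathcal{C})_2\to\mathcal{C}_1\times_{\mathcal{C}_0}\mathcal{C}_1=\mathcal{C}_2$; and presheaf structure over $\mathbb{D}( * )$ with structure map $\mathbb{D}_0\varepsilon\circ S$ and action $(f,x)\cdot\alpha=(f\circ\xi_1(\mathbb{D}_1I(\phi)),\ S_{\mathbb{D}}\phi)$, where $\phi\in\mathbb{D}_1\mathcal{C}_0$ is the unique element with $T_{\mathbb{D}}\phi=x$ and $\mathbb{D}_1\varepsilon(\phi)=\alpha$. *)

(* Defs.v *)
From HB Require Import structures.
From mathcomp Require Import all_boot all_order fingroup perm.
From mathcomp Require Import boolp.

Set Implicit Arguments.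
Unset Strict Implicit.
Unset Printing Implicit Defensive.

Local Open Scope quotient_scope.

Definition pull (X Y Z : Type) (f : X -> Z) (g : Y -> Z) : Type :=
  {p : X * Y | f p.1 = g p.2}.

Section Pull.
Context {X Y Z : Type} {f : X -> Z} {g : Y -> Z}.

Definition mkpull (x : X) (y : Y) (e : f x = g y) : pull f g :=
  exist _ (x, y) e.
Definition pfst (p : pull f g) : X := (proj1_sig p).1.
Definition psnd (p : pull f g) : Y := (proj1_sig p).2.

Lemma pullP (p : pull f g) : f (pfst p) = g (psnd p).
Proof. by case: p. Qed.

Lemma pull_eq (p q : pull f g) : pfst p = pfst q -> psnd p = psnd q -> p = q.
Proof.
case: p q => [[x y] e] [[x' y'] e'] /= E1 E2.
rewrite /pfst /psnd /= in E1 E2; case: _ / E1 in e' *.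
by case: _ / E2 in e' *; congr exist.
Qed.

End Pull.

Record cat := Cat {
  ob : Type;
  mor : Type;
  src : mor -> ob;
  tgt : mor -> ob;
  idm : ob -> mor;
  comp : forall g f : mor, src g = tgt f -> mor;
  src_idm : forall a, src (idm a) = a;
  tgt_idm : forall a, tgt (idm a) = a;
  src_comp : forall g f (e : src g = tgt f), src (comp e) = src f;
  tgt_comp : forall g f (e : src g = tgt f), tgt (comp e) = tgt g;
  comp1m : forall f (e : src (idm (tgt f)) = tgt f), comp e = f;
  compm1 : forall f (e : src f = tgt (idm (src f))), comp e = f;
  compA : forall h g f (e1 : src h = tgt g) (e2 : src g = tgt f)
    (e3 : src h = tgt (comp e2)) (e4 : src (comp e1) = tgt f),
    comp e3 = comp e4
}.
Arguments src {c}.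
Arguments tgt {c}.
Arguments idm {c}.
Arguments comp {c g f}.
Arguments src_comp {c g f}.
Arguments tgt_comp {c g f}.
Arguments comp1m {c f}.
Arguments compm1 {c f}.

Lemma comp_eq (C : cat) (g g' f f' : mor C) (e : src g = tgt f)
    (e' : src g' = tgt f') : g = g' -> f = f' -> comp e = comp e'.
Proof.
move=> E1 E2; case: _ / E1 in e' *; case: _ / E2 in e' *.
by congr comp.
Qed.

Record functor (C D : cat) := Functor {
  F0 : ob C -> ob D;
  F1 : mor C -> mor D;
  F_src : forall f, src (F1 f) = F0 (src f);
  F_tgt : forall f, tgt (F1 f) = F0 (tgt f);
  F_idm : forall a, F1 (idm a) = idm (F0 a);
  F_comp : forall g f (e : src g = tgt f) (e' : src (F1 g) = tgt (F1 f)),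
    F1 (comp e) = comp e'
}.

Definition idF (C : cat) : functor C C.
Proof. by exists id id => // g f e e'; congr comp. Defined.

(* The 2-simplices of the nerve. *)
Definition mor2 (C : cat) : Type := pull (@src C) (@tgt C).
Definition comp2 (C : cat) (p : mor2 C) : mor C := comp (pullP p).

Definition star : cat.
Proof.
by exists unit unit (fun _ => tt) (fun _ => tt) (fun _ => tt)
  (fun _ _ _ => tt) => //; case.
Defined.

Definition toStar (C : cat) : functor C star.
Proof. by exists (fun _ => tt) (fun _ => tt). Defined.

Definition prodCat (C D : cat) : cat.
Proof.
exists (ob C * ob D)%type (mor C * mor D)%type
  (fun f => (src f.1, src f.2)) (fun f => (tgt f.1, tgt f.2))
  (fun a => (idm a.1, idm a.2))
  (fun g f (e : (src g.1, src g.2) = (tgt f.1, tgt f.2)) =>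
     (@comp C g.1 f.1 (congr1 fst e), @comp D g.2 f.2 (congr1 snd e))).
- by case=> a b /=; rewrite !src_idm.
- by case=> a b /=; rewrite !tgt_idm.
- by move=> g f e /=; rewrite !src_comp.
- by move=> g f e /=; rewrite !tgt_comp.
- by move=> [f1 f2] e /=; rewrite !comp1m.
- by move=> [f1 f2] e /=; rewrite !compm1.
- by move=> h g f e1 e2 e3 e4 /=; congr pair; apply: compA.
Defined.

Definition piCat (I : Type) (C : I -> cat) : cat.
Proof.
exists (forall i, ob (C i)) (forall i, mor (C i))
  (fun f i => src (f i)) (fun f i => tgt (f i)) (fun a i => idm (a i))
  (fun g f (e : (fun i => src (g i)) = (fun i => tgt (f i))) i =>
     @comp (C i) (g i) (f i) (congr1 (fun u => u i) e)).
- by move=> a; apply: functional_extensionality_dep => i; rewrite src_idm.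
- by move=> a; apply: functional_extensionality_dep => i; rewrite tgt_idm.
- by move=> g f e; apply: functional_extensionality_dep => i; rewrite src_comp.
- by move=> g f e; apply: functional_extensionality_dep => i; rewrite tgt_comp.
- by move=> f e; apply: functional_extensionality_dep => i; rewrite comp1m.
- by move=> f e; apply: functional_extensionality_dep => i; rewrite compm1.
- move=> h g f e1 e2 e3 e4; apply: functional_extensionality_dep => i.
  exact: compA.
Defined.

Record isPresheaf (C : cat) (X : Type) (st : X -> ob C)
    (ac : forall (x : X) (f : mor C), st x = tgt f -> X) : Prop := IsPresheaf {
  psh_src : forall x f (e : st x = tgt f), st (ac x f e) = src f;
  psh_id : forall x (e : st x = tgt (idm (st x))), ac x (idm (st x)) e = x;
  psh_comp : forall x f g (e : st x = tgt f) (e' : src f = tgt g)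
    (e1 : st (ac x f e) = tgt g) (e2 : st x = tgt (comp e')),
    ac (ac x f e) g e1 = ac x (comp e') e2
}.

Record presheaf (C : cat) (X : Type) := Presheaf {
  pst : X -> ob C;
  pact : forall (x : X) (f : mor C), pst x = tgt f -> X;
  presheafP : isPresheaf pact
}.
Arguments pact {C X} p {x f}.

Definition isPshMap (C C' : cat) (F : functor C C') (X X' : Type)
    (P : presheaf C X) (P' : presheaf C' X') (h : X -> X') : Prop :=
  (forall x, pst P' (h x) = F0 F (pst P x)) /\
  (forall x f (e : pst P x = tgt f) (e' : pst P' (h x) = tgt (F1 F f)),
     h (pact P e) = pact P' e').

Lemma pact_eq (C : cat) (X : Type) (P : presheaf C X) (x x' : X)
    (f f' : mor C) (e : pst P x = tgt f) (e' : pst P x' = tgt f') :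
  x = x' -> f = f' -> pact P e = pact P e'.
Proof.
move=> E1 E2; case: _ / E1 in e' *; case: _ / E2 in e' *.
by congr pact.
Qed.

Definition setPsh (X : Type) : presheaf star X.
Proof. by exists (fun _ => tt) (fun x _ _ => x); split. Defined.

(* Permutations are composed as in the library, [(s * t) i = t (s i)], and
   ['S_n] acts on the right of the n-ary operations; operations are to be
   thought of as [(a.s)(x) = a (x \o s)]. *)
Record symSeq := SymSeq {
  ops :> nat -> Type;
  act : forall n, ops n -> 'S_n -> ops n;
  act1 : forall n (a : ops n), act a 1%g = a;
  actM : forall n (a : ops n) s t, act a (s * t)%g = act (act a s) t
}.

(* Equalities between operations whose arities are equal but not convertible
   are stated in the total space [{n & P n}].  The bijection between
   [{i & 'I_(k i)}] and ['I_(\sum_i k i)] is [tagnat.Rank], i.e. the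
   lexicographic order. *)
Record isOperad (P : nat -> Type) (ac : forall n, P n -> 'S_n -> P n)
    (u : P 1)
    (c : forall (n : nat) (k : 'I_n -> nat),
       P n -> (forall i, P (k i)) -> P (\sum_i k i)%N) : Prop := IsOperad {
  oper_act1 : forall n (a : P n), ac n a 1%g = a;
  oper_actM : forall n (a : P n) s t, ac n a (s * t)%g = ac n (ac n a s) t;
  oper_unitl : forall m (a : P m),
    Tagged P (c 1 (fun _ => m) u (fun _ => a)) = Tagged P a;
  oper_unitr : forall n (a : P n),
    Tagged P (c n (fun _ => 1) a (fun _ => u)) = Tagged P a;
  oper_assoc : forall n (k : 'I_n -> nat) (m : forall i, 'I_(k i) -> nat)
    (a : P n) (b : forall i, P (k i)) (d : forall i (j : 'I_(k i)), P (m i j)),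
    Tagged P (c _ (fun l => m (tagnat.sig1 l) (tagnat.sig2 l)) (c n k a b)
                (fun l => d (tagnat.sig1 l) (tagnat.sig2 l)))
    = Tagged P (c n (fun i => \sum_j m i j)%N a
                  (fun i => c (k i) (m i) (b i) (d i)));
  oper_equivl : forall n (k : 'I_n -> nat) (a : P n) (b : forall i, P (k i))
    (s : 'S_n) (p : 'S_(\sum_i k (s i))%N),
    (forall i (j : 'I_(k (s i))),
       p (tagnat.Rank (p_ := fun i => k (s i)) i j)
       = tagnat.Rank (p_ := k) (s i) j :> nat) ->
    Tagged P (c n k (ac n a s) b)
    = Tagged P (ac _ (c n (fun i => k (s i)) a (fun i => b (s i))) p);
  oper_equivr : forall n (k : 'I_n -> nat) (a : P n) (b : forall i, P (k i))
    (t : forall i, 'S_(k i)) (p : 'S_(\sum_i k i)%N),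
    (forall i j, p (tagnat.Rank i j) = tagnat.Rank i (t i j)) ->
    c n k a (fun i => ac _ (b i) (t i)) = ac _ (c n k a b) p
}.

Record operad := Operad {
  oseq :> symSeq;
  ounit : oseq 1;
  ocomp : forall (n : nat) (k : 'I_n -> nat),
    oseq n -> (forall i, oseq (k i)) -> oseq (\sum_i k i)%N;
  operadP : isOperad (@act oseq) ounit ocomp
}.
Arguments ocomp {o n k}.

(* The unit functor [star -> opc 1] is given by [cunit] and its identity.  The
   operad laws are equalities of functors, i.e. of their values on objects and
   on morphisms. *)
Record catOperad := CatOperad {
  opc :> nat -> cat;
  cact : forall n, 'S_n -> functor (opc n) (opc n);
  cunit : ob (opc 1);
  ccomp : forall (n : nat) (k : 'I_n -> nat),
    functor (prodCat (opc n) (piCat (fun i => opc (k i)))) (opc (\sum_i k i)%N);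
  cat_operad0 : isOperad (P := fun n => ob (opc n))
    (fun n a s => F0 (cact s) a) cunit
    (fun n k a b => F0 (@ccomp n k) (a, b));
  cat_operad1 : isOperad (P := fun n => mor (opc n))
    (fun n a s => F1 (cact s) a) (idm cunit)
    (fun n k a b => F1 (@ccomp n k) (a, b))
}.

(* Freeness on objects implies freeness on the simplices of the nerve. *)
Definition sigma_free (D : catOperad) : Prop :=
  forall n (a : ob (D n)) (s : 'S_n), F0 (cact D s) a = a -> s = 1%g.

(* The operads in sets formed by the 0- and 1-simplices of the nerves; of the
   operad of 2-simplices only the symmetric sequence is needed. *)
Section Simplices.
Variable D : catOperad.

Definition obOperad : operad :=
  @Operad (SymSeq (oper_act1 (cat_operad0 D)) (oper_actM (cat_operad0 D)))
    _ _ (cat_operad0 D).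

Definition morOperad : operad :=
  @Operad (SymSeq (oper_act1 (cat_operad1 D)) (oper_actM (cat_operad1 D)))
    _ _ (cat_operad1 D).

Lemma act_mor2_subproof n (p : mor2 (D n)) (s : 'S_n) :
  src (F1 (cact D s) (pfst p)) = tgt (F1 (cact D s) (psnd p)).
Proof. by rewrite F_src F_tgt pullP. Qed.

Definition act_mor2 n (p : mor2 (D n)) (s : 'S_n) : mor2 (D n) :=
  mkpull (act_mor2_subproof p s).

Definition mor2Seq : symSeq.
Proof.
exists (fun n => mor2 (D n)) act_mor2.
- by move=> n a; apply: pull_eq; exact: (oper_act1 (cat_operad1 D)).
- by move=> n a s t; apply: pull_eq; exact: (oper_actM (cat_operad1 D)).
Defined.

End Simplices.

Record seqMap (A B : symSeq) := SeqMap {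
  smap :> forall n, A n -> B n;
  smap_act : forall n (a : A n) s, smap (act a s) = act (smap a) s
}.

Section StructureMaps.
Variable D : catOperad.

Definition srcSeq : seqMap (morOperad D) (obOperad D).
Proof. by exists (fun n a => src a) => n a s; apply: F_src. Defined.

Definition tgtSeq : seqMap (morOperad D) (obOperad D).
Proof. by exists (fun n a => tgt a) => n a s; apply: F_tgt. Defined.

Definition idSeq : seqMap (obOperad D) (morOperad D).
Proof. by exists (fun n a => idm a) => n a s; apply: esym; apply: F_idm. Defined.

Definition compSeq : seqMap (mor2Seq D) (morOperad D).
Proof. by exists (fun n a => comp2 a) => n a s; apply: esym; apply: F_comp. Defined.

Definition fstSeq : seqMap (mor2Seq D) (morOperad D).
Proof. by exists (fun n (a : mor2 (D n)) => pfst a). Defined.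

Definition sndSeq : seqMap (mor2Seq D) (morOperad D).
Proof. by exists (fun n (a : mor2 (D n)) => psnd a). Defined.

End StructureMaps.

Definition idS (A : symSeq) : seqMap A A.
Proof. by exists (fun n a => a). Defined.

Section Orbits.
Variables (A : symSeq) (X : Type) (n : nat).

Definition tensor : Type := {classic (A n * ('I_n -> X))%type}.

(* Generated by [(a.s, x) ~ (a, x \o s)]; this is the action of ['S_n] on
   [X ^ n] for which the two actions are balanced. *)
Definition orb_rel : rel tensor := fun p q =>
  `[< exists s : 'S_n, p.1 = act q.1 s /\ q.2 = p.2 \o s >].

Lemma orb_refl : reflexive orb_rel.
Proof.
move=> p; apply/asboolP; exists 1%g; rewrite act1; split=> //.
by apply: funext => i /=; rewrite perm1.
Qed.

Lemma orb_trans : transitive orb_rel.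
Proof.
move=> q p r /asboolP[s [E1 E2]] /asboolP[t [E3 E4]]; apply/asboolP.
exists (t * s)%g; rewrite actM -E3; split=> //.
by rewrite E4 E2; apply: funext => i /=; rewrite permM.
Qed.

Lemma orb_sym : symmetric orb_rel.
Proof.
suff H p q : orb_rel p q -> orb_rel q p by move=> p q; apply/idP/idP; apply: H.
move=> /asboolP[s [E1 E2]]; apply/asboolP; exists (s^-1)%g.
rewrite E1 -actM mulgV act1 E2; split=> //.
by apply: funext => i /=; rewrite permKV.
Qed.

Canonical orb_equiv := EquivRel orb_rel orb_refl orb_sym orb_trans.

(* [A_n x_(Sigma_n) X^n] *)
Definition orbits : Type := {eq_quot orb_equiv}.

End Orbits.

(* [\coprod_n A_n x_(Sigma_n) X^n] *)
Definition dmon (A : symSeq) (X : Type) : Type := {n : nat & orbits A X n}.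

Lemma Tagged_inj (I : eqType) (T : I -> Type) i (a b : T i) :
  Tagged T a = Tagged T b -> a = b.
Proof. by move/(congr1 (untag b id)); rewrite !untagE. Qed.

Section Elements.
Variables (A : symSeq) (X : Type).

Definition el n (a : A n) (x : 'I_n -> X) : dmon A X :=
  Tagged (orbits A X) (\pi_{eq_quot (orb_equiv A X n)} ((a, x) : tensor A X n)).

(* A chosen representative. *)
Definition darity (q : dmon A X) : nat := tag q.
Definition drep (q : dmon A X) : A (darity q) * ('I_(darity q) -> X) :=
  generic_quotient.repr (tagged q : {eq_quot (orb_equiv A X (tag q))}).
Definition dop (q : dmon A X) : A (darity q) := (drep q).1.
Definition darg (q : dmon A X) : 'I_(darity q) -> X := (drep q).2.

Arguments darg : clear implicits.

Lemma el_rep (q : dmon A X) : el (dop q) (darg q) = q.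
Proof.
case: q => n c; rewrite /el /dop /darg /drep /=; congr existT.
rewrite -[RHS](@reprK _ {eq_quot (orb_equiv A X n)}).
by congr (\pi); case: (generic_quotient.repr _).
Qed.

Lemma elP (P : dmon A X -> Prop) :
  (forall n (a : A n) x, P (el a x)) -> forall q, P q.
Proof. by move=> H q; rewrite -(el_rep q). Qed.

Lemma el_act n (a : A n) (s : 'S_n) x : el (act a s) x = el a (x \o s).
Proof.
rewrite /el; congr existT; apply/eqmodP; apply/asboolP.
by exists s.
Qed.

Lemma el_eq n (a b : A n) x y : el a x = el b y ->
  exists s : 'S_n, a = act b s /\ y = x \o s.
Proof.
move=> E; have {}E := Tagged_inj E; apply/asboolP.
exact/(@eqmodP _ (orb_equiv A X n) (a, x) (b, y)).
Qed.

Lemma el_arity n m (a : A n) (b : A m) x y : el a x = el b y -> n = m.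
Proof. by move/(congr1 darity). Qed.

Lemma el_tag n m (a : A n) (b : A m) x y : Tagged A a = Tagged A b ->
  (forall (i : 'I_n) (j : 'I_m), i = j :> nat -> x i = y j) -> el a x = el b y.
Proof.
move=> E; rewrite -[a]/(tagged (Tagged A a)) -[b]/(tagged (Tagged A b)).
rewrite -[n]/(tag (Tagged A a)) in x *; rewrite -[m]/(tag (Tagged A b)) in y *.
move: (Tagged A a) (Tagged A b) E x y => p q; case: _ / => x y E.
by congr el; apply: funext => i; apply: E.
Qed.

End Elements.
Arguments darg {A X}.

Lemma funextd (I : Type) (T : I -> Type) (f g : forall i, T i) :
  (forall i, f i = g i) -> f = g.
Proof. exact: functional_extensionality_dep. Qed.

(* Functions on orbits are computed on chosen representatives; [dmapE],
   [dnatE] and [dmuE] below say that the choice is irrelevant. *)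

Definition dmap (A : symSeq) (X Y : Type) (f : X -> Y) (q : dmon A X) :
    dmon A Y :=
  el (dop q) (f \o darg q).

Definition dnat (A B : symSeq) (t : seqMap A B) (X : Type) (q : dmon A X) :
    dmon B X :=
  el (t _ (dop q)) (darg q).

Lemma dmapE (A : symSeq) X Y (f : X -> Y) n (a : A n) x :
  dmap f (el a x) = el a (f \o x).
Proof.
rewrite /dmap; move: (el_rep (el a x)).
move: (dop (el a x)) (darg (el a x)); rewrite /darity /= => b y.
by case/el_eq=> s [-> ->]; rewrite el_act.
Qed.

Lemma dnatE (A B : symSeq) (t : seqMap A B) X n (a : A n) (x : 'I_n -> X) :
  dnat t (el a x) = el (t _ a) x.
Proof.
rewrite /dnat; move: (el_rep (el a x)).
move: (dop (el a x)) (darg (el a x)); rewrite /darity /= => b y.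
by case/el_eq=> s [-> ->]; rewrite smap_act el_act.
Qed.

Section DmonTheory.
Variable A : symSeq.

Lemma dmap_id X (q : dmon A X) : dmap id q = q.
Proof. by move: q; apply: elP => n a x; rewrite dmapE. Qed.

Lemma dmap_comp X Y Z (g : Y -> Z) (f : X -> Y) (q : dmon A X) :
  dmap g (dmap f q) = dmap (g \o f) q.
Proof. by move: q; apply: elP => n a x; rewrite !dmapE. Qed.

Lemma dmap_ext X Y (f g : X -> Y) (q : dmon A X) :
  f =1 g -> dmap f q = dmap g q.
Proof. by move=> /funext ->. Qed.

Lemma dnat_dmap (B : symSeq) (t : seqMap A B) X Y (f : X -> Y) (q : dmon A X) :
  dnat t (dmap f q) = dmap f (dnat t q).
Proof. by move: q; apply: elP => n a x; rewrite !(dmapE, dnatE). Qed.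

End DmonTheory.

(* Representatives can be lifted along an equivariant map. *)
Lemma el_lift (B Z : symSeq) (t : seqMap B Z) Y W (g : Y -> W) n (u : Z n)
    (w : 'I_n -> W) (b : dmon B Y) :
  el u w = dnat t (dmap g b) ->
  exists (v : B n) (y : 'I_n -> Y), [/\ b = el v y, u = t n v & w = g \o y].
Proof.
move: b; apply: elP => m v y; rewrite !(dmapE, dnatE) => E.
have nm := el_arity E; case: _ / nm in v y E *.
case/el_eq: E => s [-> E2].
exists (act v s), (y \o (s^-1)%g); split; last 1 first.
- apply: funext => i /=; move/(congr1 (fun h => h ((s^-1)%g i))): E2 => /=.
  by rewrite permKV => ->.
- by rewrite el_act; congr el; apply: funext => i /=; rewrite permK.
- by rewrite smap_act.
Qed.

Definition isPullSeq (A B Z P : symSeq) (tA : seqMap A Z) (tB : seqMap B Z)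
    (pA : seqMap P A) (pB : seqMap P B) : Prop :=
  (forall n (p : P n), tA n (pA n p) = tB n (pB n p)) /\
  (forall n (a : A n) (b : B n), tA n a = tB n b ->
     exists! p : P n, pA n p = a /\ pB n p = b).

Definition freeSeq (A : symSeq) : Prop :=
  forall n (a : A n) (s : 'S_n), act a s = a -> s = 1%g.

Section DPull.
Variables (A B Z P : symSeq) (tA : seqMap A Z) (tB : seqMap B Z).
Variables (pA : seqMap P A) (pB : seqMap P B).
Hypotheses (pullS : isPullSeq tA tB pA pB) (freeZ : freeSeq Z).
Variables (X Y W : Type) (f : X -> W) (g : Y -> W).

Lemma dpull_el (a : dmon A X) (b : dmon B Y) :
  dnat tA (dmap f a) = dnat tB (dmap g b) ->
  exists n (p : P n) (x : 'I_n -> X) (y : 'I_n -> Y),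
    [/\ a = el (pA n p) x, b = el (pB n p) y & f \o x = g \o y].
Proof.
move: a; apply: elP => n u x; rewrite dmapE dnatE.
case/el_lift=> v [y [-> E1 E2]].
have [p [[<- <-] _]] := pullS.2 _ _ _ E1.
by exists n, p, x, y.
Qed.

Lemma dpull_ex (a : dmon A X) (b : dmon B Y) :
  dnat tA (dmap f a) = dnat tB (dmap g b) ->
  exists c : dmon P (pull f g),
    dnat pA (dmap pfst c) = a /\ dnat pB (dmap psnd c) = b.
Proof.
case/dpull_el=> n [p [x [y [-> -> E]]]].
have E' i : f (x i) = g (y i) by move/(congr1 (fun h => h i)): E.
by exists (el p (fun i => mkpull (E' i))); rewrite !(dmapE, dnatE).
Qed.

Lemma dpull_inj (c c' : dmon P (pull f g)) :
  dnat pA (dmap pfst c) = dnat pA (dmap pfst c') ->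
  dnat pB (dmap psnd c) = dnat pB (dmap psnd c') -> c = c'.
Proof.
move: c c'; apply: elP => n p z; apply: elP => m p' z'.
rewrite !(dmapE, dnatE) => E; have nm := el_arity E.
case: _ / nm in p' z' E *; case/el_eq: E => s [E1 E2].
case/el_eq=> t [E3 E4].
have st : s = t.
  have : tA n (act (pA n p') s) = tB n (act (pB n p') t).
    by rewrite -E1 -E3 pullS.1.
  rewrite !smap_act -pullS.1 => /(congr1 (fun u => act u t^-1%g)).
  rewrite -!actM mulgV act1 => /freeZ /(congr1 (fun u => (u * t)%g)).
  by rewrite mulgKV mul1g.
rewrite -st {t st} in E3 E4.
have Ep : p = act p' s.
  have [|q [_ Uq]] := pullS.2 _ (pA n p) (pB n p); first exact: pullS.1.
  have <- : q = p by apply: Uq.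
  by apply: Uq; rewrite !smap_act E1 E3.
rewrite Ep el_act; congr el; apply: funext => i /=; apply: pull_eq.
  by move/(congr1 (fun h => h i)): E2.
by move/(congr1 (fun h => h i)): E4.
Qed.

(* The inverse of the bijection
   [dmon P (X x_W Y) -> dmon A X x_(dmon Z W) dmon B Y]. *)
Definition dpair (a : dmon A X) (b : dmon B Y)
    (e : dnat tA (dmap f a) = dnat tB (dmap g b)) : dmon P (pull f g) :=
  projT1 (cid (dpull_ex e)).

Lemma dpairP (a : dmon A X) (b : dmon B Y)
    (e : dnat tA (dmap f a) = dnat tB (dmap g b)) :
  dnat pA (dmap pfst (dpair e)) = a /\ dnat pB (dmap psnd (dpair e)) = b.
Proof. exact: projT2 (cid (dpull_ex e)). Qed.

Lemma dpairE n (p : P n) (z : 'I_n -> pull f g)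
    (e : dnat tA (dmap f (el (pA n p) (pfst \o z)))
       = dnat tB (dmap g (el (pB n p) (psnd \o z)))) :
  dpair e = el p z.
Proof.
by case: (dpairP e) => E1 E2; apply: dpull_inj;
  rewrite (E1, E2) !(dmapE, dnatE).
Qed.

End DPull.
Arguments dpair {A B Z P tA tB pA pB} pullS {X Y W f g a b} e.
Arguments dpairE {A B Z P tA tB pA pB} pullS freeZ {X Y W f g n} p z e.
Arguments dpairP {A B Z P tA tB pA pB} pullS {X Y W f g a b} e.

Section Monad.
Variable O : operad.

Definition deta X (x : X) : dmon O X := el (ounit O) (fun _ => x).

Definition dmu X (q : dmon O (dmon O X)) : dmon O X :=
  el (ocomp (dop q) (fun i => dop (darg q i)))
     (fun l => darg (darg q (tagnat.sig1 l)) (tagnat.sig2 l)).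

Lemma flat_Rank (T : Type) n (k : 'I_n -> nat) (F : forall i, 'I_(k i) -> T)
    i (j : 'I_(k i)) :
  F (tagnat.sig1 (tagnat.Rank i j)) (tagnat.sig2 (tagnat.Rank i j)) = F i j.
Proof. by rewrite /tagnat.sig2 /tagnat.sig1 /tagnat.Rank tagnat.rankK. Qed.

Lemma Rank_case n (k : 'I_n -> nat) (l : 'I_(\sum_i k i)%N) :
  exists i (j : 'I_(k i)), l = tagnat.Rank i j.
Proof. by exists (tagnat.sig1 l), (tagnat.sig2 l); rewrite tagnat.sig2K. Qed.

Lemma Rank_inj n (k : 'I_n -> nat) i (j : 'I_(k i)) i' (j' : 'I_(k i')) :
  tagnat.Rank i j = tagnat.Rank i' j' ->
  Tagged (fun i => 'I_(k i)) j = Tagged (fun i => 'I_(k i)) j'.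
Proof. exact: tagnat.rank_inj. Qed.

Lemma flatten_fiber X n (k k' : 'I_n -> nat) (a : O n)
    (b : forall i, O (k i)) (b' : forall i, O (k' i))
    (x : forall i, 'I_(k i) -> X) (x' : forall i, 'I_(k' i) -> X) :
  (forall i, el (b i) (x i) = el (b' i) (x' i)) ->
  el (ocomp a b) (fun l => x (tagnat.sig1 l) (tagnat.sig2 l))
  = el (ocomp a b') (fun l => x' (tagnat.sig1 l) (tagnat.sig2 l)).
Proof.
move=> E; have kk : k = k' by apply: funext => i; apply: el_arity (E i).
case: _ / kk in b' x' E *.
pose t i : 'S_(k i) := projT1 (cid (el_eq (E i))).
have tP i : b i = act (b' i) (t i) /\ x' i = x i \o t i.
  exact: projT2 (cid (el_eq (E i))).
pose h (l : 'I_(\sum_i k i)%N) : 'I_(\sum_i k i)%N :=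
  tagnat.Rank (tagnat.sig1 l) (t _ (tagnat.sig2 l)).
have hR i j : h (tagnat.Rank i j) = tagnat.Rank i (t i j).
  exact: (flat_Rank (fun i j => tagnat.Rank i (t i j))).
have h_inj : injective h.
  move=> l l'; have [i [j ->]] := Rank_case l.
  have [i' [j' ->]] := Rank_case l'; rewrite !hR => /Rank_inj E2.
  have ii : i = i' by apply: (congr1 tag E2).
  by case: _ / ii in j' E2 *; have {}E2 := Tagged_inj E2; rewrite (perm_inj E2).
have -> : b = fun i => act (b' i) (t i) by apply: funextd => i; case: (tP i).
have -> : x' = fun i => x i \o t i by apply: funextd => i; case: (tP i).
rewrite (@oper_equivr _ _ _ _ (operadP O) n k a b' t (perm h_inj)); last first.
  by move=> i j; rewrite permE hR.
rewrite el_act; congr el; apply: funext => l /=; rewrite permE /h.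
by rewrite (flat_Rank x).
Qed.

Lemma flatten_act X n (k : 'I_n -> nat) (a : O n) (s : 'S_n)
    (b : forall i, O (k i)) (x : forall i, 'I_(k i) -> X) :
  el (ocomp (act a s) b) (fun l => x (tagnat.sig1 l) (tagnat.sig2 l))
  = el (ocomp a (fun i => b (s i)))
       (fun l => x (s (tagnat.sig1 l)) (tagnat.sig2 l)).
Proof.
have E : (\sum_i k i = \sum_i k (s i))%N.
  by rewrite (reindex_inj (@perm_inj _ s)).
pose h (l : 'I_(\sum_i k (s i))%N) : 'I_(\sum_i k (s i))%N :=
  cast_ord E (tagnat.Rank (p_ := k) (s (tagnat.sig1 l)) (tagnat.sig2 l)).
have hR i j : h (tagnat.Rank (p_ := fun i => k (s i)) i j)
            = cast_ord E (tagnat.Rank (p_ := k) (s i) j).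
  exact: (flat_Rank (k := fun i => k (s i))
           (fun i j => cast_ord E (tagnat.Rank (p_ := k) (s i) j))).
have h_inj : injective h.
  move=> l l'; have [i [j ->]] := Rank_case l.
  have [i' [j' ->]] := Rank_case l'; rewrite !hR => /cast_ord_inj/Rank_inj E2.
  have ii : i = i' by apply: (@perm_inj _ s); apply: (congr1 tag E2).
  by case: _ / ii in j' E2 *; rewrite (Tagged_inj E2).
have T := @oper_equivl _ _ _ _ (operadP O) n k a b s (perm h_inj).
rewrite (el_tag (y := (fun l => x (s (tagnat.sig1 l)) (tagnat.sig2 l))
                        \o (perm h_inj)^-1%g) (T _)).
- rewrite el_act; congr el; apply: funext => l /=; by rewrite permK.
- by move=> i j; rewrite permE hR.
move=> l l' /= ll'; rewrite -(permKV (perm h_inj) l') in ll' *.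
move: ((perm h_inj)^-1%g l') ll' => m; have [i [j ->]] := Rank_case m.
rewrite permK permE hR => ll'.
have -> : l = tagnat.Rank (p_ := k) (s i) j by apply: val_inj.
rewrite (flat_Rank x).
by rewrite (flat_Rank (k := fun i => k (s i)) (fun i j => x (s i) j)).
Qed.

Lemma dmuE X n (k : 'I_n -> nat) (a : O n) (b : forall i, O (k i))
    (x : forall i, 'I_(k i) -> X) :
  dmu (el a (fun i => el (b i) (x i)))
  = el (ocomp a b) (fun l => x (tagnat.sig1 l) (tagnat.sig2 l)).
Proof.
rewrite /dmu; set y := (fun i => _); move: (el_rep (el a y)).
move: (dop (el a y)) (darg (el a y)); rewrite /darity /= => d z.
case/el_eq=> s [-> E].
rewrite (flatten_act a s (fun i => dop (z i)) (fun i => darg (z i))).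
apply: (flatten_fiber a (x := fun i => darg (z (s i)))) => i.
by rewrite el_rep -[z (s i)]/((z \o s) i) -E.
Qed.

Lemma el2P X (P : dmon O (dmon O X) -> Prop) :
  (forall n (k : 'I_n -> nat) (a : O n) (b : forall i, O (k i))
     (x : forall i, 'I_(k i) -> X), P (el a (fun i => el (b i) (x i)))) ->
  forall q, P q.
Proof.
move=> H; apply: elP => n a y.
have -> : y = fun i => el (dop (y i)) (darg (y i)).
  by apply: funext => i; rewrite el_rep.
exact: H.
Qed.

Lemma deta_nat X Y (f : X -> Y) (x : X) : dmap f (deta x) = deta (f x).
Proof. by rewrite /deta dmapE. Qed.

Lemma dmu_nat X Y (f : X -> Y) (q : dmon O (dmon O X)) :
  dmap f (dmu q) = dmu (dmap (dmap f) q).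
Proof.
move: q; apply: el2P => n k a b x; rewrite dmuE !dmapE.
have -> : dmap f \o (fun i => el (b i) (x i)) = fun i => el (b i) (f \o x i).
  by apply: funext => i /=; rewrite dmapE.
by rewrite dmuE.
Qed.


End Monad.
Arguments deta O {X} x.

Section DCat.
Variable D : catOperad.
Hypothesis HD : sigma_free D.

Local Notation O0 := (obOperad D).
Local Notation O1 := (morOperad D).

Lemma compSeq_pull :
  isPullSeq (srcSeq D) (tgtSeq D) (fstSeq D) (sndSeq D).
Proof.
split=> [n p|n a b e]; first exact: pullP.
exists (mkpull e); split=> // q [E1 E2].
by apply: pull_eq; [exact: esym E1 | exact: esym E2].
Qed.

Lemma tgtSeq_pull : isPullSeq (idS O0) (tgtSeq D) (tgtSeq D) (idS O1).
Proof. by split=> // n a b /= e; exists b; split=> // q []. Qed.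

Lemma dnat_idS (A : symSeq) X (q : dmon A X) : dnat (idS A) q = q.
Proof. by move: q; apply: elP => n a x; rewrite dnatE. Qed.

Section Category.
Variable C : cat.

Definition Dsrc (q : dmon O1 (mor C)) : dmon O0 (ob C) :=
  dnat (srcSeq D) (dmap src q).
Definition Dtgt (q : dmon O1 (mor C)) : dmon O0 (ob C) :=
  dnat (tgtSeq D) (dmap tgt q).
Definition Didm (q : dmon O0 (ob C)) : dmon O1 (mor C) :=
  dnat (idSeq D) (dmap idm q).
Definition Dcomp (q p : dmon O1 (mor C)) (e : Dsrc q = Dtgt p) :
    dmon O1 (mor C) :=
  dnat (compSeq D) (dmap (@comp2 C) (dpair compSeq_pull e)).

Lemma DsrcE n (a : O1 n) (x : 'I_n -> mor C) :
  Dsrc (el a x) = el (src (a : mor (D n)) : O0 n) (src \o x).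
Proof. by rewrite /Dsrc dmapE dnatE. Qed.

Lemma DtgtE n (a : O1 n) (x : 'I_n -> mor C) :
  Dtgt (el a x) = el (tgt (a : mor (D n)) : O0 n) (tgt \o x).
Proof. by rewrite /Dtgt dmapE dnatE. Qed.

Lemma DidmE n (a : O0 n) (x : 'I_n -> ob C) :
  Didm (el a x) = el (idm (a : ob (D n)) : O1 n) (idm \o x).
Proof. by rewrite /Didm dmapE dnatE. Qed.

Lemma Dcomp_el n (a b : mor (D n)) (x y : 'I_n -> mor C)
    (h : src a = tgt b) (hi : forall i, src (x i) = tgt (y i))
    (e : Dsrc (el (a : O1 n) x) = Dtgt (el (b : O1 n) y)) :
  Dcomp e = el (comp h : O1 n) (fun i => comp (hi i)).
Proof.
rewrite /Dcomp.
rewrite (dpairE compSeq_pull HD (mkpull h : mor2Seq D n)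
           (fun i => mkpull (hi i))).
rewrite dmapE dnatE /=; congr el; first by rewrite /comp2; congr comp.
by apply: funext => i /=; rewrite /comp2; congr comp.
Qed.

Lemma Dcomp_lift n (a : O1 n) (x : 'I_n -> mor C) (p : dmon O1 (mor C)) :
  Dsrc (el a x) = Dtgt p -> exists (b : O1 n) (y : 'I_n -> mor C),
    [/\ p = el b y, src (a : mor (D n)) = tgt (b : mor (D n))
       & forall i, src (x i) = tgt (y i)].
Proof.
rewrite /Dsrc dmapE dnatE => /el_lift [b [y [-> E1 E2]]].
by exists b, y; split=> // i; move/(congr1 (fun h => h i)): E2.
Qed.

End Category.

(* Composition is the composite
   [D_1 C_1 x_(D_0 C_0) D_1 C_1 ~ D_2 C_2 -> D_1 C_1]. *)
Definition DCat (C : cat) : cat.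
Proof.
exists (dmon O0 (ob C)) (dmon O1 (mor C)) (@Dsrc C) (@Dtgt C) (@Didm C)
  (@Dcomp C).
- apply: elP => n a x; rewrite /Dsrc /Didm !(dmapE, dnatE) /= src_idm.
  by congr el; apply: funext => i /=; rewrite src_idm.
- apply: elP => n a x; rewrite /Dtgt /Didm !(dmapE, dnatE) /= tgt_idm.
  by congr el; apply: funext => i /=; rewrite tgt_idm.
- apply: elP => n a x p e; have [b [y [Ep h hi]]] := Dcomp_lift e.
  case: _ / (esym Ep) in e *; rewrite (Dcomp_el h hi) /Dsrc !(dmapE, dnatE) /=.
  by rewrite src_comp; congr el; apply: funext => i /=; rewrite src_comp.
- apply: elP => n a x p e; have [b [y [Ep h hi]]] := Dcomp_lift e.
  case: _ / (esym Ep) in e *; rewrite (Dcomp_el h hi) /Dtgt !(dmapE, dnatE) /=.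
  by rewrite tgt_comp; congr el; apply: funext => i /=; rewrite tgt_comp.
- apply: elP => n a x.
  have -> : Didm (Dtgt (el a x)) = el (idm (tgt (a : mor (D n))) : O1 n)
                                      (fun i => idm (tgt (x i))).
    by rewrite /Didm /Dtgt !(dmapE, dnatE).
  move=> e; rewrite (Dcomp_el (src_idm _) (fun i => src_idm _)) comp1m.
  by congr el; apply: funext => i; rewrite comp1m.
- apply: elP => n a x.
  have -> : Didm (Dsrc (el a x)) = el (idm (src (a : mor (D n))) : O1 n)
                                      (fun i => idm (src (x i))).
    by rewrite /Didm /Dsrc !(dmapE, dnatE).
  move=> e; rewrite (Dcomp_el (esym (tgt_idm _)) (fun i => esym (tgt_idm _))) compm1.
  by congr el; apply: funext => i; rewrite compm1.
- apply: elP => n a x q p e1.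
  have [b [y [Eq h hi]]] := Dcomp_lift e1; case: _ / (esym Eq) in e1 * => e2.
  have [c [z [Ep k ki]]] := Dcomp_lift e2; case: _ / (esym Ep) in e2 *.
  rewrite (Dcomp_el h hi) (Dcomp_el k ki) => e3 e4.
  have h' : src (a : mor (D n)) = tgt (comp k) by rewrite tgt_comp.
  have hi' i : src (x i) = tgt (comp (ki i)) by rewrite tgt_comp.
  have k' : src (comp h) = tgt (c : mor (D n)) by rewrite src_comp.
  have ki' i : src (comp (hi i)) = tgt (z i) by rewrite src_comp.
  rewrite (Dcomp_el h' hi') (Dcomp_el k' ki'); congr el; first exact: compA.
  by apply: funext => i; apply: compA.
Defined.

Section Dfun.
Variables (C C' : cat) (F : functor C C').

Lemma Dfun_src (q : dmon O1 (mor C)) :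
  Dsrc (dmap (F1 F) q) = dmap (F0 F) (Dsrc q).
Proof.
move: q; apply: elP => n a x; rewrite dmapE !DsrcE dmapE; congr el.
by apply: funext => i; apply: F_src.
Qed.

Lemma Dfun_tgt (q : dmon O1 (mor C)) :
  Dtgt (dmap (F1 F) q) = dmap (F0 F) (Dtgt q).
Proof.
move: q; apply: elP => n a x; rewrite dmapE !DtgtE dmapE; congr el.
by apply: funext => i; apply: F_tgt.
Qed.

Lemma Dfun_idm (q : dmon O0 (ob C)) :
  dmap (F1 F) (Didm q) = Didm (dmap (F0 F) q).
Proof.
move: q; apply: elP => n a x; rewrite dmapE !DidmE dmapE; congr el.
by apply: funext => i; apply: F_idm.
Qed.

Lemma Dfun_comp (q p : dmon O1 (mor C)) (e : Dsrc q = Dtgt p)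
    (e' : Dsrc (dmap (F1 F) q) = Dtgt (dmap (F1 F) p)) :
  dmap (F1 F) (Dcomp e) = Dcomp e'.
Proof.
move: q e e'; apply: elP => n a x e.
have [b [y [Ep h hi]]] := Dcomp_lift e.
case: _ / (esym Ep) in e *; rewrite (Dcomp_el h hi) !dmapE => e'.
have hi' i : src (F1 F (x i)) = tgt (F1 F (y i)) by rewrite F_src F_tgt hi.
rewrite (Dcomp_el h hi'); congr el.
by apply: funext => i; apply: F_comp.
Qed.

Definition Dfun : functor (DCat C) (DCat C') :=
  @Functor (DCat C) (DCat C') (dmap (F0 F)) (dmap (F1 F))
    Dfun_src Dfun_tgt Dfun_idm Dfun_comp.

End Dfun.

Section EtaF.
Variable C : cat.

Lemma etaF_src (f : mor C) : Dsrc (deta O1 f) = deta O0 (src f).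
Proof. by rewrite /deta DsrcE; congr el; apply: src_idm. Qed.

Lemma etaF_tgt (f : mor C) : Dtgt (deta O1 f) = deta O0 (tgt f).
Proof. by rewrite /deta DtgtE; congr el; apply: tgt_idm. Qed.

Lemma etaF_idm (a : ob C) : deta O1 (idm a) = Didm (deta O0 a).
Proof. by rewrite /deta DidmE. Qed.

Lemma etaF_comp (g f : mor C) (e : src g = tgt f)
    (e' : Dsrc (deta O1 g) = Dtgt (deta O1 f)) :
  deta O1 (comp e) = Dcomp e'.
Proof.
have h : src (idm (cunit D)) = tgt (idm (cunit D)).
  by rewrite src_idm tgt_idm.
rewrite [RHS](Dcomp_el h (fun=> e)); congr el.
have h' : src (idm (cunit D)) = tgt (idm (src (idm (cunit D)))).
  by rewrite tgt_idm.
rewrite -[LHS](compm1 h'); apply: comp_eq => //.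
by rewrite src_idm.
Qed.

Definition etaF : functor C (DCat C) :=
  @Functor C (DCat C) (@deta O0 _) (@deta O1 _)
    etaF_src etaF_tgt etaF_idm etaF_comp.

End EtaF.

Section MuF.
Variable C : cat.

Lemma muF_src (q : dmon O1 (dmon O1 (mor C))) :
  Dsrc (dmu q) = dmu (@Dsrc (DCat C) q).
Proof.
move: q; apply: el2P => n k a b x; rewrite dmuE !DsrcE.
have -> : @src (DCat C) \o (fun i => el (b i) (x i)) =
    fun i => el (src (b i : mor (D (k i))) : O0 (k i)) (src \o x i).
  by apply: funext => i; apply: DsrcE.
by rewrite dmuE; congr el; apply: F_src.
Qed.

Lemma muF_tgt (q : dmon O1 (dmon O1 (mor C))) :
  Dtgt (dmu q) = dmu (@Dtgt (DCat C) q).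
Proof.
move: q; apply: el2P => n k a b x; rewrite dmuE !DtgtE.
have -> : @tgt (DCat C) \o (fun i => el (b i) (x i)) =
    fun i => el (tgt (b i : mor (D (k i))) : O0 (k i)) (tgt \o x i).
  by apply: funext => i; apply: DtgtE.
by rewrite dmuE; congr el; apply: F_tgt.
Qed.

Lemma muF_idm (q : dmon O0 (dmon O0 (ob C))) :
  dmu (@Didm (DCat C) q) = Didm (dmu q).
Proof.
move: q; apply: el2P => n k a b x; rewrite dmuE !DidmE.
have -> : @idm (DCat C) \o (fun i => el (b i) (x i)) =
    fun i => el (idm (b i : ob (D (k i))) : O1 (k i)) (idm \o x i).
  by apply: funext => i; apply: DidmE.
by rewrite dmuE; congr el; apply: (F_idm (@ccomp D n k) (a, b)).
Qed.

Lemma muF_comp (q p : dmon O1 (dmon O1 (mor C)))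
    (e : @Dsrc (DCat C) q = @Dtgt (DCat C) p) (e' : Dsrc (dmu q) = Dtgt (dmu p)) :
  dmu (@Dcomp (DCat C) _ _ e) = Dcomp e'.
Proof.
move: q e e'; apply: el2P => n k a b x e.
have [c [z [Ep h hz]]] := Dcomp_lift e.
case: _ / (esym Ep) in e *; rewrite (Dcomp_el h hz).
have H i : exists (d : O1 (k i)) (y : 'I_(k i) -> mor C),
    [/\ z i = el d y, src (b i : mor (D (k i))) = tgt (d : mor (D (k i)))
       & forall j, src (x i j) = tgt (y j)] by apply: Dcomp_lift (hz i).
pose d i := projT1 (cid (H i)).
pose y i := projT1 (cid (projT2 (cid (H i)))).
have dyP i : [/\ z i = el (d i) (y i),
    src (b i : mor (D (k i))) = tgt (d i : mor (D (k i)))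
    & forall j, src (x i j) = tgt (y i j)].
  exact: projT2 (cid (projT2 (cid (H i)))).
move: d y dyP => d y dyP.
have Ez : z = fun i => el (d i) (y i) by apply: funext => i; case: (dyP i).
case: _ / (esym Ez) in e hz Ep *.
have hb i : src (b i : mor (D (k i))) = tgt (d i : mor (D (k i))).
  by case: (dyP i).
have hx i j : src (x i j) = tgt (y i j) by case: (dyP i).
have -> : (fun i => comp (hz i)) =
          fun i => el (comp (hb i) : O1 (k i)) (fun j => comp (hx i j)).
  by apply: funext => i; apply: Dcomp_el.
rewrite !dmuE => e'.
have hab : src (F1 (@ccomp D n k) (a, b)) = tgt (F1 (@ccomp D n k) (c, d)).
  rewrite F_src F_tgt; congr (F0 _ _) => /=; congr pair => //.
  by apply: funextd => i.
rewrite (Dcomp_el hab (fun l => hx _ _)); congr el.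
have hp : @src (prodCat (D n) (piCat (fun i => D (k i)))) (a, b)
        = @tgt (prodCat (D n) (piCat (fun i => D (k i)))) (c, d).
  by congr pair => //; apply: funextd => i.
rewrite -(F_comp hp) /=; congr (F1 _ _); congr pair; first exact: comp_eq.
by apply: funextd => i; apply: comp_eq.
Qed.

Definition muF : functor (DCat (DCat C)) (DCat C) :=
  @Functor (DCat (DCat C)) (DCat C) (@dmu O0 _) (@dmu O1 _)
    muF_src muF_tgt muF_idm muF_comp.

End MuF.

Section DPsh.
Variables (C : cat) (X : Type) (P : presheaf C X).

Lemma Dact_subproof (x : dmon O0 X) (f : mor (DCat C)) :
  dmap (pst P) x = tgt f ->
  dnat (idS O0) (dmap (pst P) x) = dnat (tgtSeq D) (dmap tgt f).
Proof. by rewrite dnat_idS. Qed.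

(* [D_0 X x_(D_0 C_0) D_1 C_1 ~ D_1 (X x_(C_0) C_1) -> D_1 X -> D_0 X] *)
Definition Dact (x : dmon O0 X) (f : mor (DCat C))
    (e : dmap (pst P) x = tgt f) : dmon O0 X :=
  dnat (srcSeq D) (dmap (fun p => pact P (pullP p))
    (dpair tgtSeq_pull (Dact_subproof e))).

Lemma Dact_el n (b : mor (D n)) (x : 'I_n -> X) (y : 'I_n -> mor C)
    (hi : forall i, pst P (x i) = tgt (y i))
    (e : dmap (pst P) (el (tgt b : O0 n) x)
       = Dtgt (el (b : O1 n) y)) :
  Dact e = el (src b : O0 n) (fun i => pact P (hi i)).
Proof.
rewrite /Dact.
rewrite (dpairE tgtSeq_pull HD (b : O1 n) (fun i => mkpull (hi i))).
rewrite dmapE dnatE; congr el; apply: funext => i /=.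
by congr pact.
Qed.

Lemma Dact_lift (x : dmon O0 X) (f : dmon O1 (mor C)) :
  dmap (pst P) x = Dtgt f -> exists n (b : mor (D n)) (z : 'I_n -> X)
    (y : 'I_n -> mor C),
    [/\ x = el (tgt b : O0 n) z, f = el (b : O1 n) y
       & forall i, pst P (z i) = tgt (y i)].
Proof.
move: x; apply: elP => n a z; rewrite dmapE.
case/el_lift=> b [y [-> -> E]]; exists n, b, z, y; split=> // i.
by move/(congr1 (fun h => h i)): E.
Qed.

Lemma Dact_isPresheaf : isPresheaf Dact.
Proof.
split.
- move=> x f e; have [n [b [z [y [Ex Ef h]]]]] := Dact_lift e.
  case: _ / (esym Ex) in e *; case: _ / (esym Ef) in e *.
  rewrite (Dact_el h) dmapE -[RHS]/(Dsrc _) DsrcE; congr el.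
  by apply: funext => i /=; rewrite (psh_src (presheafP P)).
- apply: elP => n a z.
  have -> : @idm (DCat C) (dmap (pst P) (el a z)) =
            el (idm (a : ob (D n)) : O1 n) (fun i => idm (pst P (z i))).
    by rewrite dmapE; apply: DidmE.
  move: (tgt_idm (a : ob (D n))) => E.
  have Ea : el a z = el (tgt (idm (a : ob (D n))) : O0 n) z by congr el.
  move=> e; transitivity (el (src (idm (a : ob (D n))) : O0 n) z); last first.
    by congr el; apply: src_idm.
  have h i : pst P (z i) = tgt (idm (pst P (z i))) by rewrite tgt_idm.
  case: _ / (esym Ea) in e *; rewrite (Dact_el h); congr el.
  by apply: funext => i; rewrite (psh_id (presheafP P)).
- move=> x f g e; have [n [b [z [y [Ex Ef h]]]]] := Dact_lift e.
  case: _ / (esym Ex) in e *; case: _ / (esym Ef) in e * => e'.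
  have [c [w [Eg k ki]]] := Dcomp_lift e'; case: _ / (esym Eg) in e' *.
  rewrite (Dact_el h) [comp e'](Dcomp_el k ki).
  have h1 i : pst P (pact P (h i)) = tgt (w i).
    by rewrite (psh_src (presheafP P)) ki.
  have h2 i : pst P (z i) = tgt (comp (ki i)) by rewrite tgt_comp.
  have E1 : el (src b : O0 n) (fun i => pact P (h i)) =
            el (tgt (c : mor (D n)) : O0 n) (fun i => pact P (h i)).
    by congr el.
  case: _ / (esym E1) => e1.
  have E2 : el (tgt b : O0 n) z = el (tgt (comp k) : O0 n) z.
    by congr el; rewrite tgt_comp.
  case: _ / (esym E2) in e * => e2.
  rewrite (Dact_el h1) (Dact_el h2) src_comp; congr el; apply: funext => i.
  exact: (psh_comp (presheafP P)).
Qed.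

Definition DPsh : presheaf (DCat C) (dmon O0 X) := Presheaf Dact_isPresheaf.

End DPsh.

Lemma DPsh_map (C C' : cat) (F : functor C C') X X' (P : presheaf C X)
    (P' : presheaf C' X') (h : X -> X') :
  isPshMap F P P' h -> isPshMap (Dfun F) (DPsh P) (DPsh P') (dmap h).
Proof.
case=> H1 H2.
have K1 (q : dmon O0 X) : dmap (pst P') (dmap h q) = dmap (F0 F) (dmap (pst P) q).
  by rewrite !dmap_comp; apply: dmap_ext.
have K2 (q : dmon O0 X) (f : dmon O1 (mor C)) (e : dmap (pst P) q = Dtgt f)
    (e' : dmap (pst P') (dmap h q) = Dtgt (dmap (F1 F) f)) :
    dmap h (@Dact C X P q f e) = @Dact C' X' P' _ _ e'.
  have [n [b [z [y [Ex Ef hi]]]]] := Dact_lift e.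
  case: _ / (esym Ex) in e e' *; case: _ / (esym Ef) in e e' *.
  have hi' i : pst P' (h (z i)) = tgt (F1 F (y i)) by rewrite H1 F_tgt hi.
  rewrite (Dact_el hi); move: e'; rewrite !(dmapE h) (dmapE (F1 F)) => e'.
  rewrite [RHS](Dact_el (P := P') (x := h \o z) (y := F1 F \o y) hi').
  by congr el; apply: funext => i; apply: H2.
by split.
Qed.

End DCat.

Section Multicategory.
Variables (D : catOperad) (HD : sigma_free D).

Local Notation O0 := (obOperad D).
Local Notation O1 := (morOperad D).
Local Notation "'DD' C" := (DCat HD C) (at level 10, C at level 9).

Section M2.
Variables (M0 M1 : Type) (P : presheaf (DD star) M1).
Variables (T : M1 -> M0) (S : M1 -> dmon O0 M0).
Hypothesis T_map : isPshMap (toStar (DD star)) P (setPsh M0) T.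
Hypothesis S_map : isPshMap (idF (DD star)) P (DPsh HD (setPsh M0)) S.

Local Notation M2 := (pull S (dmap T)).
Local Notation P0 := (DPsh HD (setPsh M0)).
Local Notation P1 := (DPsh HD P).
Local Notation Deps := (Dfun HD (toStar (DD star))).

Definition M2_st (p : M2) : ob (DD (DD star)) := pst P1 (psnd p).

Lemma M2_act1 (p : M2) (f : mor (DD (DD star))) :
  M2_st p = tgt f -> pst P (pfst p) = tgt (F1 Deps f).
Proof.
move=> e; rewrite -[LHS]/(F0 (idF (DD star)) (pst P (pfst p))) -S_map.1 pullP.
by rewrite F_tgt -e; apply: (DPsh_map HD T_map).1.
Qed.

Lemma M2_act2 (p : M2) (f : mor (DD (DD star))) (e : M2_st p = tgt f) :
  S (pact P (M2_act1 e)) = dmap T (@pact _ _ P1 (psnd p) f e).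
Proof.
have e1 : pst P0 (S (pfst p)) = tgt (F1 (idF _) (F1 Deps f)).
  by rewrite S_map.1; apply: M2_act1.
have e2 : pst P0 (dmap T (psnd p)) = tgt (F1 Deps f).
  by rewrite -pullP S_map.1; apply: M2_act1.
rewrite (S_map.2 _ _ _ e1) ((DPsh_map HD T_map).2 _ _ _ e2).
by apply: pact_eq => //; apply: pullP.
Qed.

Definition M2_act (p : M2) (f : mor (DD (DD star))) (e : M2_st p = tgt f) :
  M2 := mkpull (M2_act2 e).

Lemma M2_isPresheaf : isPresheaf M2_act.
Proof.
split.
- by move=> p f e; apply: (psh_src (presheafP P1)).
- move=> p e; apply: pull_eq; last exact: (psh_id (presheafP P1)).
  rewrite /M2_act /pfst /=.
  have h : pst P (pfst p) = tgt (idm (pst P (pfst p))) by rewrite tgt_idm.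
  rewrite -[RHS](psh_id (presheafP P) h); apply: pact_eq => //.
  transitivity (idm (F0 Deps (M2_st p))); first exact: (F_idm Deps).
  by congr idm; rewrite (M2_act1 e) F_tgt tgt_idm.
- move=> p f g e e' e1 e2; apply: pull_eq; last first.
    exact: (psh_comp (presheafP P1)).
  have h : src (F1 Deps f) = tgt (F1 Deps g) by rewrite F_src F_tgt e'.
  have h1 : pst P (pact P (M2_act1 e)) = tgt (F1 Deps g).
    by rewrite (psh_src (presheafP P)).
  have h2 : pst P (pfst p) = tgt (comp h) by rewrite tgt_comp (M2_act1 e).
  transitivity (pact P h1); first exact: pact_eq.
  rewrite (psh_comp (presheafP P) h1 h2); apply: pact_eq => //.
  by rewrite (F_comp e' h).
Qed.

Definition M2_psh : presheaf (DD (DD star)) M2 := Presheaf M2_isPresheaf.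

End M2.

(* The bare data, not subject to any law; [mst] and [mact]
    are the data of a presheaf structure on [mc1] over [DD star]. *)
Record multicatData := MulticatData {
  mc0 : Type;
  mc1 : Type;
  mst : mc1 -> ob (DD star);
  mact : forall (m : mc1) (f : mor (DD star)), mst m = tgt f -> mc1;
  mT : mc1 -> mc0;
  mS : mc1 -> dmon O0 mc0;
  mI : mc0 -> mc1;
  mcomp : pull mS (dmap mT) -> mc1
}.

Definition mc2 (M : multicatData) : Type := pull (@mS M) (dmap (@mT M)).
Definition m2T (M : multicatData) (p : mc2 M) : mc1 M := pfst p.
Definition m2S (M : multicatData) (p : mc2 M) : dmon O0 (mc1 M) := psnd p.
Definition mc3 (M : multicatData) : Type := pull (@m2S M) (dmap (@m2T M)).
Definition m3T (M : multicatData) (p : mc3 M) : mc2 M := pfst p.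
Definition m3S (M : multicatData) (p : mc3 M) : dmon O0 (mc2 M) := psnd p.

Section Laws.
Variable M : multicatData.

Lemma unitl_subproof (SI : forall a : mc0 M, mS (mI a) = deta O0 a)
    (m : mc1 M) : mS (mI (mT m)) = dmap (@mT M) (deta O0 m).
Proof. by rewrite SI deta_nat. Qed.

Lemma unitr_subproof (TI : forall a : mc0 M, mT (mI a) = a) (m : mc1 M) :
  mS m = dmap (@mT M) (dmap (@mI M) (mS m)).
Proof.
by rewrite dmap_comp -[LHS]dmap_id; apply: dmap_ext => a /=; rewrite TI.
Qed.

Lemma compT_subproof
    (Sg : forall p : mc2 M, mS (mcomp p) = dmu (dmap (@mS M) (m2S p)))
    (p : mc3 M) :
  mS (mcomp (m3T p)) = dmap (@mT M) (dmu (dmap (@m2S M) (m3S p))).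
Proof.
rewrite Sg dmu_nat; congr dmu.
rewrite (pullP p : m2S (m3T p) = dmap (@m2T M) (m3S p)) !dmap_comp.
by apply: dmap_ext => q /=; apply: pullP.
Qed.

Lemma compS_subproof (Tg : forall p : mc2 M, mT (mcomp p) = mT (m2T p))
    (p : mc3 M) :
  mS (m2T (m3T p)) = dmap (@mT M) (dmap (@mcomp M) (m3S p)).
Proof.
rewrite (pullP (m3T p) : mS (m2T (m3T p)) = dmap (@mT M) (m2S (m3T p))).
rewrite (pullP p : m2S (m3T p) = dmap (@m2T M) (m3S p)) !dmap_comp.
by apply: dmap_ext => q /=; rewrite Tg.
Qed.

Definition compT Sg (p : mc3 M) : mc2 M := mkpull (compT_subproof Sg p).
Definition compS Tg (p : mc3 M) : mc2 M := mkpull (compS_subproof Tg p).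

(* Later fields use earlier ones: the presheaf structure on [mc2] exists because
   source and target are maps of presheaves, and the elements of [mc2] in the
   unit and associativity laws are in the fiber product by the laws on the
   source and target of identities and composites. *)
Record isMulticategory : Prop := IsMulticategory {
  mc_psh : isPresheaf (@mact M);
  mc_T : isPshMap (toStar (DD star)) (Presheaf mc_psh) (setPsh (mc0 M)) (@mT M);
  mc_S : isPshMap (idF (DD star)) (Presheaf mc_psh)
           (DPsh HD (setPsh (mc0 M))) (@mS M);
  mc_I : isPshMap (etaF HD star) (setPsh (mc0 M)) (Presheaf mc_psh) (@mI M);
  mc_comp : isPshMap (muF HD star) (M2_psh mc_T mc_S) (Presheaf mc_psh)
              (@mcomp M);
  mc_SI : forall a : mc0 M, mS (mI a) = deta O0 a;
  mc_TI : forall a : mc0 M, mT (mI a) = a;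
  mc_Tcomp : forall p : mc2 M, mT (mcomp p) = mT (m2T p);
  mc_Scomp : forall p : mc2 M, mS (mcomp p) = dmu (dmap (@mS M) (m2S p));
  mc_unitl : forall m : mc1 M, mcomp (mkpull (unitl_subproof mc_SI m)) = m;
  mc_unitr : forall m : mc1 M, mcomp (mkpull (unitr_subproof mc_TI m)) = m;
  mc_assoc : forall p : mc3 M,
    mcomp (compT mc_Scomp p) = mcomp (compS mc_Tcomp p)
}.

End Laws.

Record algebra := Algebra {
  acat :> cat;
  axi : functor (DD acat) acat;
  axi_eta0 : forall c : ob acat, F0 axi (F0 (etaF HD acat) c) = c;
  axi_eta1 : forall f : mor acat, F1 axi (F1 (etaF HD acat) f) = f;
  axi_mu0 : forall q : ob (DD (DD acat)),
    F0 axi (F0 (Dfun HD axi) q) = F0 axi (F0 (muF HD acat) q);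
  axi_mu1 : forall q : mor (DD (DD acat)),
    F1 axi (F1 (Dfun HD axi) q) = F1 axi (F1 (muF HD acat) q)
}.

Section Underlying.
Variable C : algebra.

Local Notation xi0 := (F0 (axi C) : dmon O0 (ob C) -> ob C).
Local Notation xi1 := (F1 (axi C) : dmon O1 (mor C) -> mor C).
Local Notation U1 := (pull (@src C) xi0).

Definition U_kappa1 (m : U1) : mor C := pfst m.
Definition U_src (m : U1) : dmon O0 (ob C) := psnd m.
Definition U_tgt (m : U1) : ob C := tgt (U_kappa1 m).

Lemma U_id_subproof (a : ob C) : src (idm a) = xi0 (deta O0 a).
Proof. by rewrite src_idm; apply/esym/(axi_eta0 a). Qed.

Definition U_id (a : ob C) : U1 := mkpull (U_id_subproof a).

Local Notation U2 := (pull U_src (dmap U_tgt)).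

Lemma U_kappa2_subproof (p : U2) :
  src (U_kappa1 (pfst p))
  = tgt (xi1 (dnat (idSeq D) (dmap U_kappa1 (psnd p)))).
Proof.
rewrite (F_tgt (axi C)) (pullP (pfst p)); congr F0.
rewrite (pullP p : psnd (pfst p) = _) -[RHS]/(Dtgt _).
move: (psnd p); apply: elP => n a x.
by rewrite !dmapE dnatE DtgtE /= tgt_idm.
Qed.

Definition U_kappa2 (p : U2) : mor2 C := mkpull (U_kappa2_subproof p).

Lemma U_comp_subproof (p : U2) :
  src (comp2 (U_kappa2 p)) = xi0 (dmu (dmap U_src (psnd p))).
Proof.
rewrite /comp2 src_comp (F_src (axi C)).
rewrite -[dmu _]/(F0 (muF HD C) (dmap U_src (psnd p))) -axi_mu0; congr F0.
have H (q : dmon O0 U1) :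
    Dsrc (dnat (idSeq D) (dmap U_kappa1 q)) = dmap xi0 (dmap U_src q).
  move: q; apply: elP => n a x; rewrite !dmapE dnatE DsrcE src_idm; congr el.
  by apply: funext => i; apply: (pullP (x i)).
exact: H.
Qed.

Definition U_comp (p : U2) : U1 := mkpull (U_comp_subproof p).

Definition U_st (m : U1) : ob (DD star) := F0 (Dfun HD (toStar C)) (U_src m).

(* [phi] is an element of [D_1 C_0], and [dmap (fun _ => tt)] is [D_1] of the
   terminal map of [C_0]. *)
Lemma U_lift_ex (x : dmon O0 (ob C)) (al : dmon O1 unit) :
  dmap (fun _ => tt) x = @Dtgt D star al ->
  exists phi : dmon O1 (ob C),
    dnat (tgtSeq D) phi = x /\ dmap (fun _ => tt) phi = al.
Proof.
move: x; apply: elP => n a z; rewrite dmapE.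
case/el_lift=> b [y [-> -> _]]; exists (el b z); rewrite dnatE dmapE.
by split=> //; congr el; apply: funext => i /=; case: (y i).
Qed.

Lemma U_lift_uniq (phi phi' : dmon O1 (ob C)) :
  dnat (tgtSeq D) phi = dnat (tgtSeq D) phi' ->
  dmap (fun _ => tt) phi = dmap (fun _ => tt) phi' -> phi = phi'.
Proof.
move=> E1 E2.
pose j (c : ob C) : pull (fun _ : ob C => tt) (fun _ : unit => tt) :=
  mkpull (erefl : (fun _ => tt) c = (fun _ => tt) tt).
have jK (q : dmon O1 (ob C)) : dmap pfst (dmap j q) = q.
  by rewrite dmap_comp -[RHS]dmap_id; apply: dmap_ext.
suff E : dmap j phi = dmap j phi' by rewrite -(jK phi) E jK.
apply: (dpull_inj (tgtSeq_pull D) HD); first by rewrite !jK.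
by rewrite !dnat_idS !dmap_comp; apply: E2.
Qed.

Definition U_lift (x : dmon O0 (ob C)) (al : mor (DD star))
    (e : F0 (Dfun HD (toStar C)) x = tgt al) : dmon O1 (ob C) :=
  projT1 (cid (U_lift_ex e)).

Lemma U_liftP (x : dmon O0 (ob C)) (al : mor (DD star))
    (e : F0 (Dfun HD (toStar C)) x = tgt al) :
  dnat (tgtSeq D) (U_lift e) = x /\ dmap (fun _ => tt) (U_lift e) = al.
Proof. exact: projT2 (cid (U_lift_ex e)). Qed.

Lemma U_act_subproof1 (m : U1) (al : mor (DD star)) (e : U_st m = tgt al) :
  src (U_kappa1 m) = tgt (xi1 (dmap idm (U_lift e))).
Proof.
rewrite (F_tgt (axi C)) (pullP m) -[psnd m](U_liftP e).1; congr F0.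
move: (U_lift e); apply: elP => n a x.
rewrite dmapE -[RHS]/(Dtgt _) DtgtE dnatE; congr el.
by apply: funext => i /=; rewrite tgt_idm.
Qed.

Lemma U_act_subproof2 (m : U1) (al : mor (DD star)) (e : U_st m = tgt al) :
  src (comp (U_act_subproof1 e)) = xi0 (dnat (srcSeq D) (U_lift e)).
Proof.
rewrite src_comp (F_src (axi C)); congr F0.
move: (U_lift e); apply: elP => n a x.
rewrite dmapE -[LHS]/(Dsrc _) DsrcE dnatE; congr el.
by apply: funext => i /=; rewrite src_idm.
Qed.

Definition U_act (m : U1) (al : mor (DD star)) (e : U_st m = tgt al) : U1 :=
  mkpull (U_act_subproof2 e).

Definition underlying : multicatData :=
  @MulticatData (ob C) U1 U_st U_act U_tgt U_src U_id U_comp.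

End Underlying.
End Multicategory.

(* Main.v *)
From mathcomp Require Import all_boot all_order fingroup perm.
From mathcomp Require Import boolp.
Require Import Defs.

Set Implicit Arguments.
Unset Strict Implicit.
Unset Printing Implicit Defensive.

(** Write [f * g] for composition in [C].  An element of [(U C)_1] is a
    morphism [f] of [C] together with an expression of its source as [xi_0 x].
    On the components [f], composition in [U C] and the action of [D( * )] only
    precompose with values of [xi_1]: composition with [q] precomposes with
    [xi_kappa q = xi_1 (I_D (kappa_1 q))], and the action of [alpha] precomposes
    with [xi_idm phi = xi_1 (D_1 I phi)], where [phi] is the lift of [alpha]
    along [x].  The laws of [U C] are therefore equations between composites of
    such morphisms, next to equations in [D_0 C_0] that hold by the monad laws
    and by naturality.

    Two facts reduce these equations to computations with representatives
    [el a x] of orbits.  By functoriality of [xi] ([xi_comp]), composing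
    [xi_1 (b; x_i)] with [xi_1 (c; y_i)] composes [b] with [c] and each [x_i]
    with [y_i].  By compatibility of [xi] with the multiplication ([xi_mu]),
    [xi_kappa] and [xi_idm] of a multiplied element are [xi_1] of their values
    on its entries ([xi_kappa_mu], [xi_idm_mu]); for [xi_kappa] this uses that
    [I_D] is a map of monads.

    - Associativity amounts to [xi_kappa (D_0 gamma r)
      = xi_kappa (D_0 T r) * xi_kappa (mu (D_0 S r))], which is [xi_kappa_comp]:
      both sides are [xi_1 (id_a; f_i * xi_kappa q_i)] when
      [r = (a; (f_i, q_i))].
    - Composition is equivariant because of an interchange law.  Let
      [(b; alpha_i)] in [D_1 (D_1 ( * ))] act on a composable pair with outer
      morphism [f] and inner entries [(f_i, x_i)], and let [phi_i] be the lift
      of [alpha_i] along [x_i].  Acting first gives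
      [f * xi_1 (b; id) * xi_1 (id; f_i * xi_idm phi_i)], composing first gives
      [f * xi_1 (id; f_i) * xi_1 (b; xi_idm phi_i)], and both equal
      [f * xi_1 (b; f_i * xi_idm phi_i)].

    Sigma-freeness enters through the uniqueness of the lift [phi] and the
    well-defined composition and actions of [D C]. *)

Section CompositesWithIdentities.
Variable C : cat.

Lemma comp_idr (g f : mor C) (h : src g = tgt f) a :
  f = idm a -> comp h = g.
Proof.
move=> E; have h' : src g = tgt (idm (src g)) by rewrite tgt_idm.
by rewrite -[RHS](compm1 h'); apply: comp_eq => //; rewrite h E tgt_idm.
Qed.

Lemma comp_idl (g f : mor C) (h : src g = tgt f) a :
  g = idm a -> comp h = f.
Proof.
move=> E; have h' : src (idm (tgt f)) = tgt f by rewrite src_idm.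
by rewrite -[RHS](comp1m h'); apply: comp_eq => //; rewrite -h E src_idm.
Qed.

End CompositesWithIdentities.

(** * The monad of an operad in sets *)

(** In the lexicographic order, the pairs before [h = (i0, j0)] are those with
    a smaller first component and those with first component [i0] and a smaller
    second one.  This computes the rank of an element of a twofold sum of
    ordinals, which identifies the input labels on the two sides of
    associativity. *)
Lemma sum_before n (k : 'I_n -> nat) (m : forall i, 'I_(k i) -> nat)
    (h : 'I_(\sum_i k i)) :
  \sum_(l < \sum_i k i | l < h) m (tagnat.sig1 l) (tagnat.sig2 l)
  = \sum_(i < n | i < tagnat.sig1 h) \sum_j m i j
    + \sum_(j < k (tagnat.sig1 h) | j < tagnat.sig2 h) m (tagnat.sig1 h) j.
Proof.
rewrite (reindex _ (onW_bij _ tagnat.rank_bij)).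
have -> : \sum_(p : {i & 'I_(k i)} | tagnat.rank p < h)
            m (tagnat.sig1 (tagnat.rank p)) (tagnat.sig2 (tagnat.rank p))
        = \sum_(i < n) \sum_(j < k i | tagnat.Rank i j < h) m i j.
  rewrite [RHS]sig_big_dep /=.
  by apply: eq_big => [[i j]|[i j] _] //=; apply: (flat_Rank m).
have ltR i (j : 'I_(k i)) : (tagnat.Rank i j < h) =
    (i <= tagnat.sig1 h) && ((tagnat.sig1 h <= i) ==>
      (j < tagged_as (Tagged (fun i => 'I_(k i)) j) (tagnat.sig h))).
  transitivity (tagnat.sig (tagnat.Rank i j) < tagnat.sig h)%O.
    by rewrite tagnat.lt_sig.
  by rewrite tagnat.rankK Order.SigmaOrder.ltEsig.
rewrite (bigID (fun i : 'I_n => i < tagnat.sig1 h)) /=; congr (_ + _).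
  apply: eq_bigr => i ih; apply: eq_bigl => j.
  by rewrite ltR (ltnW ih) leqNgt ih.
rewrite (bigD1 (tagnat.sig1 h)) ?ltnn //= [X in _ + X]big1 ?addn0.
  by apply: eq_bigl => j; rewrite ltR leqnn tagnat.sigE12 tagged_asE.
move=> i /andP[ih ni]; apply: big_pred0 => j; rewrite ltR.
move: ih; rewrite -leqNgt leq_eqVlt val_eqE eq_sym (negPf ni).
by rewrite ltnNge => /negPf ->.
Qed.

Section MonadLaws.
Variable O : operad.

Lemma dmu_deta X (q : dmon O X) : dmu (deta O q) = q.
Proof.
move: q; apply: elP => n a x.
rewrite /deta (dmuE (ounit O) (fun=> a) (fun=> x)).
apply: el_tag; first exact: (oper_unitl (operadP O)).
move=> l j; have [i [j' ->]] := Rank_case l.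
rewrite (flat_Rank (fun _ => x)) tagnat.RankEsum ord1 big_pred0 //.
by move=> /val_inj ->.
Qed.

Lemma dmu_dmap_deta X (q : dmon O X) : dmu (dmap (@deta O X) q) = q.
Proof.
move: q; apply: elP => n a x; rewrite dmapE.
rewrite (dmuE a (fun=> ounit O) (fun i _ => x i)).
apply: el_tag; first exact: (oper_unitr (operadP O)).
move=> l j; have [i [j' ->]] := Rank_case l.
rewrite (flat_Rank (fun i _ => x i)) tagnat.RankEsum ord1 addn0.
rewrite (big_ord_narrow (ltnW (ltn_ord i))) sum1_card card_ord => E.
by congr x; apply: val_inj.
Qed.

(** The operad law equates the operations only in the total space over all
    arities, so the two families of inputs are compared through the numerical
    values of their labels. *)
Lemma dmu_assoc X (q : dmon O (dmon O (dmon O X))) :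
  dmu (dmu q) = dmu (dmap (@dmu O X) q).
Proof.
move: q; apply: el2P => n k a b y.
pose m i j := darity (y i j); pose d i j := dop (y i j).
pose x i j := darg (y i j).
have -> : y = fun i j => el (d i j) (x i j).
  by apply: funextd => i; apply: funextd => j; rewrite el_rep.
rewrite dmuE dmapE.
have -> : @dmu O X \o (fun i => el (b i) (fun j => el (d i j) (x i j))) =
   fun i => el (ocomp (b i) (d i))
     (fun l => x i (tagnat.sig1 l) (tagnat.sig2 l)).
  by apply: funext => i; apply: dmuE.
rewrite (dmuE (ocomp a b) (fun l => d (tagnat.sig1 l) (tagnat.sig2 l))
          (fun l => x (tagnat.sig1 l) (tagnat.sig2 l))).
rewrite (dmuE a (fun i => ocomp (b i) (d i))
  (fun i l => x i (tagnat.sig1 l) (tagnat.sig2 l))).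
apply: el_tag; first exact: (oper_assoc (operadP O)).
move=> l l'; have [h [r ->]] := Rank_case l => ll'.
(* [l = ((i, j), r)] and [l' = (i, (j, r))] have the same rank. *)
have -> : l' = tagnat.Rank (p_ := fun i => \sum_j m i j)%N (tagnat.sig1 h)
    (tagnat.Rank (p_ := m (tagnat.sig1 h)) (tagnat.sig2 h) r).
  apply: val_inj; rewrite -[LHS]ll' -[RHS]/(nat_of_ord _) !tagnat.RankEsum.
  by rewrite (sum_before m) addnA.
rewrite (flat_Rank (fun h => x (tagnat.sig1 h) (tagnat.sig2 h))).
rewrite (flat_Rank (fun i l => x i (tagnat.sig1 l) (tagnat.sig2 l))).
by rewrite (flat_Rank (x _)).
Qed.
End MonadLaws.

(** * Maps of monads induced by the structure maps *)

Section OperadMaps.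
Variables (O O' : operad) (t : seqMap O O').
Hypothesis t_comp : forall n (k : 'I_n -> nat) (a : O n)
  (b : forall i, O (k i)), t _ (ocomp a b) = ocomp (t _ a) (fun i => t _ (b i)).

Lemma dnat_mu X (q : dmon O (dmon O X)) :
  dnat t (dmu q) = dmu (dnat t (dmap (@dnat O O' t X) q)).
Proof.
move: q; apply: el2P => n k a b x; rewrite dmuE dmapE !dnatE t_comp.
have -> : @dnat O O' t X \o (fun i => el (b i) (x i)) =
    fun i => el (t _ (b i)) (x i).
  by apply: funext => i; apply: dnatE.
by rewrite dmuE.
Qed.

End OperadMaps.

Section StructureMaps.
Variable D : catOperad.

Lemma srcSeq_comp n (k : 'I_n -> nat) (a : morOperad D n)
    (b : forall i, morOperad D (k i)) :
  srcSeq D _ (ocomp a b) = ocomp (srcSeq D _ a) (fun i => srcSeq D _ (b i)).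
Proof. exact: F_src. Qed.

Lemma tgtSeq_comp n (k : 'I_n -> nat) (a : morOperad D n)
    (b : forall i, morOperad D (k i)) :
  tgtSeq D _ (ocomp a b) = ocomp (tgtSeq D _ a) (fun i => tgtSeq D _ (b i)).
Proof. exact: F_tgt. Qed.

Lemma idSeq_comp n (k : 'I_n -> nat) (a : obOperad D n)
    (b : forall i, obOperad D (k i)) :
  idSeq D _ (ocomp a b) = ocomp (idSeq D _ a) (fun i => idSeq D _ (b i)).
Proof. exact: esym (F_idm (@ccomp D n k) (a, b)). Qed.

End StructureMaps.

(** * Values of the algebra structure on morphisms *)

Section Underlying.
Variables (D : catOperad) (HD : sigma_free D) (C : algebra HD).

Local Notation O0 := (obOperad D).
Local Notation O1 := (morOperad D).
Local Notation xi0 := (F0 (axi C) : dmon O0 (ob C) -> ob C).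
Local Notation xi1 := (F1 (axi C) : dmon O1 (mor C) -> mor C).
Local Notation U1 := (mc1 (underlying C)).
Local Notation U2 := (mc2 (underlying C)).
Local Notation U3 := (mc3 (underlying C)).
Local Notation k1 := (@U_kappa1 D HD C).
Local Notation S := (@U_src D HD C).
Local Notation T := (@U_tgt D HD C).

Lemma xi_src n (b : mor (D n)) (x : 'I_n -> mor C) :
  src (xi1 (el (b : O1 n) x)) = xi0 (el (src b : O0 n) (src \o x)).
Proof. by rewrite (F_src (axi C)) -[src _]/(Dsrc _) DsrcE. Qed.

Lemma xi_tgt n (b : mor (D n)) (x : 'I_n -> mor C) :
  tgt (xi1 (el (b : O1 n) x)) = xi0 (el (tgt b : O0 n) (tgt \o x)).
Proof. by rewrite (F_tgt (axi C)) -[tgt _]/(Dtgt _) DtgtE. Qed.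

Lemma xi_comp n (b c : mor (D n)) (x y : 'I_n -> mor C) (h : src b = tgt c)
    (hi : forall i, src (x i) = tgt (y i))
    (e : src (xi1 (el (b : O1 n) x)) = tgt (xi1 (el (c : O1 n) y))) :
  comp e = xi1 (el (comp h : O1 n) (fun i => comp (hi i))).
Proof.
have e0 : Dsrc (el (b : O1 n) x) = Dtgt (el (c : O1 n) y).
  rewrite DsrcE DtgtE h; congr el; apply: funext => i; exact: hi.
rewrite -(Dcomp_el HD h hi e0); apply: esym.
exact: (@F_comp _ _ (axi C) _ _ e0 e).
Qed.

(** The form in which [xi_comp] is applied: the two composed morphisms are only
    propositionally values of [xi_1]. *)
Lemma xi_compE (f g : mor C) n (b c : mor (D n)) (x y : 'I_n -> mor C)
    (h : src b = tgt c) (hi : forall i, src (x i) = tgt (y i)) :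
  f = xi1 (el (b : O1 n) x) -> g = xi1 (el (c : O1 n) y) ->
  forall e : src f = tgt g,
    comp e = xi1 (el (comp h : O1 n) (fun i => comp (hi i))).
Proof. by move=> -> -> e; apply: xi_comp. Qed.

Lemma xi_mu (q : dmon O1 (dmon O1 (mor C))) : xi1 (dmu q) = xi1 (dmap xi1 q).
Proof. exact: esym (axi_mu1 q). Qed.

(** The factor by which the action of a morphism of [D( * )] with lift [phi]
    precomposes. *)
Definition xi_idm (phi : dmon O1 (ob C)) : mor C := xi1 (dmap idm phi).

(** The factor by which composition with [q] precomposes; it is the second
    component of [kappa_2]. *)
Definition xi_kappa (q : dmon O0 U1) : mor C :=
  xi1 (dnat (idSeq D) (dmap k1 q)).

Lemma xi_idmE n (b : mor (D n)) (x : 'I_n -> ob C) :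
  xi_idm (el (b : O1 n) x) = xi1 (el (b : O1 n) (idm \o x)).
Proof. by rewrite /xi_idm dmapE. Qed.

Lemma xi_kappaE n (a : ob (D n)) (x : 'I_n -> U1) :
  xi_kappa (el (a : O0 n) x) = xi1 (el (idm a : O1 n) (k1 \o x)).
Proof. by rewrite /xi_kappa dmapE dnatE. Qed.

Lemma xi_idm_src phi : src (xi_idm phi) = xi0 (dnat (srcSeq D) phi).
Proof.
move: phi; apply: elP => n b x; rewrite xi_idmE xi_src dnatE; congr F0.
by congr el; apply: funext => i; apply: src_idm.
Qed.

Lemma xi_idm_tgt phi : tgt (xi_idm phi) = xi0 (dnat (tgtSeq D) phi).
Proof.
move: phi; apply: elP => n b x; rewrite xi_idmE xi_tgt dnatE; congr F0.
by congr el; apply: funext => i; apply: tgt_idm.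
Qed.

Lemma xi_kappa_tgt q : tgt (xi_kappa q) = xi0 (dmap T q).
Proof.
move: q; apply: elP => n b x; rewrite xi_kappaE xi_tgt dmapE; congr F0.
by congr el; apply: tgt_idm.
Qed.

Lemma xi_idm_mu (q : dmon O1 (dmon O1 (ob C))) :
  xi_idm (dmu q) = xi1 (dmap xi_idm q).
Proof. by rewrite /xi_idm dmu_nat xi_mu dmap_comp. Qed.

Lemma xi_kappa_deta m : xi_kappa (deta O0 m) = k1 m.
Proof. by rewrite xi_kappaE; apply: (axi_eta1 (k1 m)). Qed.

Lemma xi_kappa_id x : xi_kappa (dmap (@U_id D HD C) x) = idm (xi0 x).
Proof. by rewrite /xi_kappa dmap_comp -(F_idm (axi C)); congr F1. Qed.

Lemma xi_kappa_mu (q : dmon O0 (dmon O0 U1)) :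
  xi_kappa (dmu q) = xi1 (dnat (idSeq D) (dmap xi_kappa q)).
Proof.
rewrite /xi_kappa dmu_nat (dnat_mu (@idSeq_comp D)) xi_mu.
rewrite -!dnat_dmap !dmap_comp; congr F1; congr dnat; apply: dmap_ext => r.
Qed.

(** * Actions and composites in the underlying multicategory *)

(** Any element with the two projections of the lift may replace the chosen
    one.  The composability proof in the second part is arbitrary, so that the
    equation can be used whichever proof occurs in the goal. *)
Lemma U_actE (m : U1) al (e : U_st m = tgt al) phi :
  dnat (tgtSeq D) phi = S m -> dmap (fun=> tt) phi = al ->
  S (U_act e) = dnat (srcSeq D) phi /\
  forall h : src (k1 m) = tgt (xi_idm phi), k1 (U_act e) = comp h.
Proof.
move=> Et Ea; have [Et' Ea'] := U_liftP e.
have E : U_lift e = phi.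
  by apply: (@U_lift_uniq D HD C); rewrite ?Et' ?Ea' ?Et ?Ea.
split=> [|h]; first by rewrite -E.
by apply: comp_eq => //; rewrite E.
Qed.

Lemma U_act_el (m : U1) al (e : U_st m = tgt al) n (b : mor (D n))
    (x : 'I_n -> ob C) :
  S m = el (tgt b : O0 n) x -> al = el (b : O1 n) (fun=> tt) ->
  S (U_act e) = el (src b : O0 n) x /\
  forall h : src (k1 m) = tgt (xi1 (el (b : O1 n) (idm \o x))),
    k1 (U_act e) = comp h.
Proof.
move=> Em Eal.
have Et : dnat (tgtSeq D) (el (b : O1 n) x) = S m by rewrite dnatE Em.
have Ea : dmap (fun=> tt) (el (b : O1 n) x) = al by rewrite dmapE Eal.
by have := U_actE e Et Ea; rewrite dnatE xi_idmE.
Qed.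

Lemma U_act_lift (m : U1) al (e : U_st m = tgt al) :
  exists n (b : mor (D n)) (x : 'I_n -> ob C),
    S m = el (tgt b : O0 n) x /\ al = el (b : O1 n) (fun=> tt).
Proof.
have [] := U_liftP e; move: (U_lift e).
apply: (@elP O1 (ob C)) => n b x.
by rewrite dnatE dmapE => <- <-; exists n, b, x.
Qed.

Lemma U_compE (p : U2) m q (h : src (k1 m) = tgt (xi_kappa q)) :
  pfst p = m -> psnd p = q -> k1 (U_comp p) = comp h.
Proof.
by move=> E1 E2; exact: comp_eq (congr1 k1 E1) (congr1 xi_kappa E2).
Qed.

Lemma U_srcP (m : U1) : src (k1 m) = xi0 (S m).
Proof. exact: pullP m. Qed.

Lemma U_eq (m m' : U1) : k1 m = k1 m' -> S m = S m' -> m = m'.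
Proof. exact: pull_eq. Qed.

Lemma U_stE (m : U1) : U_st m = dmap (fun=> tt) (S m).
Proof. by []. Qed.

(** * The laws of the underlying multicategory *)

(** If [b] and [c] are composable and act along [x], the two lifts [(b; x)] and
    [(c; x)] compose to [(b * c; x)], the lift of the composite. *)
Lemma U_isPresheaf : isPresheaf (@U_act D HD C).
Proof.
split.
- move=> m al e; have [n [b [x [Em Eal]]]] := U_act_lift e.
  have [Es _] := U_act_el e Em Eal.
  by rewrite U_stE Es Eal dmapE -[RHS]/(Dsrc _) DsrcE.
- move=> m e.
  have [n [a [x Em]]] : exists n (a : O0 n) x, S m = el a x.
    by exists (darity (S m)), (dop (S m)), (darg (S m)); rewrite el_rep.
  have Et : S m = el (tgt (idm (a : ob (D n))) : O0 n) x by rewrite tgt_idm.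
  have Eal : idm (U_st m) = el (idm (a : ob (D n)) : O1 n) (fun=> tt)
      :> mor (DCat HD star).
    by rewrite U_stE Em dmapE; apply: DidmE.
  have [Es Ek] := U_act_el e Et Eal.
  have Ei : xi1 (el (idm (a : ob (D n)) : O1 n) (idm \o x)) = idm (src (k1 m)).
    by rewrite U_srcP Em -(F_idm (axi C)) -DidmE.
  have h : src (k1 m) = tgt (xi1 (el (idm (a : ob (D n)) : O1 n) (idm \o x))).
    by rewrite Ei tgt_idm.
  apply: U_eq; last by rewrite Es src_idm Em.
  by rewrite (Ek h); apply: comp_idr Ei.
- move=> m al be e e' e1 e2.
  have [n [b [x [Em Eal]]]] := U_act_lift e.
  have [Es Ek] := U_act_el e Em Eal.
  have eb := e'; rewrite Eal in eb.
  have [c [y [Ebe h _]]] := Dcomp_lift eb.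
  have Ey : y = fun=> tt by apply: funext => i; case: (y i).
  rewrite {}Ey in Ebe.
  have hs i : src (idm (x i)) = tgt (idm (x i)) by rewrite src_idm tgt_idm.
  have Ecomp : comp e' = el (comp h : O1 n) (fun=> tt) :> mor (DCat HD star).
    have st (i : 'I_n) : @src star tt = @tgt star tt by [].
    move: (e'); rewrite Eal Ebe => e3.
    exact: (Dcomp_el HD h st e3).
  have Es' : S (U_act e) = el (tgt c : O0 n) x by rewrite Es h.
  have [Es1 Ek1] := U_act_el e1 Es' Ebe.
  have Es2' : S m = el (tgt (comp h) : O0 n) x by rewrite tgt_comp.
  have [Es2 Ek2] := U_act_el e2 Es2' Ecomp.
  apply: U_eq; last by rewrite Es1 Es2 src_comp.
  have hb : src (k1 m) = tgt (xi1 (el (b : O1 n) (idm \o x))).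
    by rewrite U_srcP Em -xi_idmE xi_idm_tgt dnatE.
  have hc : src (k1 (U_act e)) = tgt (xi1 (el (c : O1 n) (idm \o x))).
    by rewrite U_srcP Es' -xi_idmE xi_idm_tgt dnatE.
  have hbc : src (k1 m) = tgt (xi1 (el (comp h : O1 n) (idm \o x))).
    by rewrite U_srcP Es2' -xi_idmE xi_idm_tgt dnatE.
  rewrite (Ek1 hc) (Ek2 hbc).
  have hm : src (xi1 (el (b : O1 n) (idm \o x)))
          = tgt (xi1 (el (c : O1 n) (idm \o x))).
    by rewrite -!xi_idmE xi_idm_src xi_idm_tgt !dnatE /= h.
  have h1 : src (comp hb) = tgt (xi1 (el (c : O1 n) (idm \o x))).
    by rewrite src_comp.
  have h2 : src (k1 m) = tgt (comp hm) by rewrite tgt_comp.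
  transitivity (comp h1); first exact: comp_eq.
  rewrite -(compA h2); apply: comp_eq => //.
  rewrite (xi_comp h hs); congr F1; congr el; apply: funext => i /=.
  exact: comp_idr (erefl _).
Qed.

Definition U_psh : presheaf (DCat HD star) U1 := Presheaf U_isPresheaf.

Lemma U_tgt_map : isPshMap (toStar (DCat HD star)) U_psh (setPsh (ob C)) T.
Proof. by split=> // m al e e'; apply: tgt_comp. Qed.

Lemma U_src_map :
  isPshMap (idF (DCat HD star)) U_psh (DPsh HD (setPsh (ob C))) S.
Proof.
split=> // m al e e'; have [n [b [x [Em Eal]]]] := U_act_lift e.
have [Es _] := U_act_el e Em Eal.
transitivity (el (src b : O0 n) x); first exact: Es.
move: e'; rewrite Em Eal => e'.
have st (i : 'I_n) : pst (setPsh (ob C)) (x i) = @tgt star tt by [].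
exact: esym (Dact_el HD st e').
Qed.

Lemma U_id_map : isPshMap (etaF HD star) (setPsh (ob C)) U_psh (@U_id D HD C).
Proof.
split=> [a|a [] e e']; first exact: deta_nat.
have Et : S (U_id a) = el (tgt (idm (cunit D)) : O0 1) (fun=> a).
  by rewrite tgt_idm.
have [Es Ek] := U_act_el e' Et (erefl _).
apply: U_eq; last by rewrite Es src_idm.
have Ei : xi1 (el (idm (cunit D) : O1 1) (idm \o (fun=> a))) = idm a.
  exact: (axi_eta1 (idm a)).
have h : src (k1 (U_id a)) =
    tgt (xi1 (el (idm (cunit D) : O1 1) (idm \o (fun=> a)))).
  by rewrite Ei src_idm tgt_idm.
by rewrite (Ek h); apply: esym; apply: comp_idr Ei.
Qed.

(** The interchange of [b] with the inner morphisms [f_i] described above; the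
    lift of [mu (b; alpha_i)] along the source of the composite is
    [mu (b; phi_i)]. *)
Lemma U_comp_map :
  isPshMap (muF HD star) (M2_psh U_tgt_map U_src_map) U_psh (@U_comp D HD C).
Proof.
split=> [p|p f e e'].
  rewrite -[LHS]/(dmap (fun=> tt) (dmu (dmap S (psnd p)))) dmu_nat dmap_comp.
  exact: (erefl (dmu _)).
have [n [b [z [y [Eq Ef hi]]]]] := Dact_lift (P := U_psh) e.
pose phi i := U_lift (hi i : U_st (z i) = tgt (y i)).
have [Et Ea] : (forall i, dnat (tgtSeq D) (phi i) = S (z i)) /\
               (forall i, dmap (fun=> tt) (phi i) = y i).
  by split=> i; have [] := U_liftP (hi i : U_st (z i) = tgt (y i)).
have [Es Ek] : (forall i, S (U_act (hi i)) = dnat (srcSeq D) (phi i)) /\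
    (forall i (h : src (k1 (z i)) = tgt (xi_idm (phi i))),
       k1 (U_act (hi i)) = comp h).
  by split=> i; have [] := U_actE (hi i) (Et i) (Ea i).
set p' := pact _ e.
have Em : S (pfst p) = el (tgt b : O0 n) (T \o z).
  by rewrite -[LHS]/(S (pfst p)) (pullP p) Eq dmapE.
have Eal : F1 (Dfun HD (toStar (DCat HD star))) f = el (b : O1 n) (fun=> tt).
  by rewrite Ef; apply: dmapE.
have [Esm Ekm] := U_act_el (M2_act1 U_tgt_map U_src_map e) Em Eal.
have Eq' : psnd p' = el (src b : O0 n) (fun i => U_act (hi i)).
  have e0 : dmap (pst U_psh) (el (tgt b : O0 n) z) = Dtgt (el (b : O1 n) y).
    by rewrite -Eq -Ef.
  rewrite -(Dact_el HD hi e0).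
  exact: (@pact_eq _ _ (DPsh HD U_psh) _ _ _ _ e e0 Eq Ef).
pose Phi : dmon O1 (ob C) := dmu (el (b : O1 n) phi).
have EtPhi : dnat (tgtSeq D) Phi = S (U_comp p).
  rewrite -[RHS]/(dmu (dmap S (psnd p))) Eq /Phi (dnat_mu (@tgtSeq_comp D)).
  by rewrite !dmapE dnatE; congr dmu; congr el; apply: funext.
have EaPhi : dmap (fun=> tt) Phi = F1 (muF HD star) f.
  rewrite -[RHS]/(dmu f) Ef /Phi dmu_nat dmapE.
  by congr dmu; congr el; apply: funext.
have [EsPhi EkPhi] := U_actE e' EtPhi EaPhi.
apply: U_eq; last first.
  rewrite EsPhi -[LHS]/(dmu (dmap S (psnd p'))) Eq' dmapE.
  rewrite /Phi (dnat_mu (@srcSeq_comp D)) dmapE dnatE.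
  by congr dmu; congr el; apply: funext.
(* [A] and [B] are the factors that arise by acting before composing, [K] and
   [L] those that arise by composing first. *)
have hA : src (k1 (pfst p)) = tgt (xi1 (el (b : O1 n) (idm \o (T \o z)))).
  by rewrite U_srcP Em -xi_idmE xi_idm_tgt dnatE.
have hK : src (k1 (pfst p)) = tgt (xi_kappa (el (tgt b : O0 n) z)).
  by rewrite -Eq; exact: U_kappa2_subproof p.
have hB : src (k1 (pfst p')) =
    tgt (xi_kappa (el (src b : O0 n) (fun i => U_act (hi i)))).
  by rewrite -Eq'; exact: U_kappa2_subproof p'.
have hL : src (k1 (U_comp p)) = tgt (xi_idm Phi).
  by rewrite U_srcP -EtPhi xi_idm_tgt.
rewrite (EkPhi hL) (U_compE hB (erefl _) Eq').
have hAB : src (xi1 (el (b : O1 n) (idm \o (T \o z))))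
    = tgt (xi_kappa (el (src b : O0 n) (fun i => U_act (hi i)))).
  rewrite -xi_idmE xi_idm_src xi_kappa_tgt dnatE dmapE; congr F0; congr el.
  apply: funext => i; exact: esym (tgt_comp _).
have hKL : src (xi_kappa (el (tgt b : O0 n) z)) = tgt (xi_idm Phi).
  by rewrite -(src_comp hK) -hL; congr src; apply: esym; apply: U_compE.
have hAB1 : src (comp hA) =
    tgt (xi_kappa (el (src b : O0 n) (fun i => U_act (hi i)))).
  by rewrite src_comp.
have hAB2 : src (k1 (pfst p)) = tgt (comp hAB) by rewrite tgt_comp.
have hKL1 : src (comp hK) = tgt (xi_idm Phi) by rewrite src_comp.
have hKL2 : src (k1 (pfst p)) = tgt (comp hKL) by rewrite tgt_comp.
transitivity (comp hAB1); first by apply: comp_eq => //; apply: Ekm.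
transitivity (comp hKL1); last first.
  by apply: comp_eq => //; apply: esym; apply: U_compE.
rewrite -(compA hAB2) -(compA hKL2); apply: comp_eq => //.
(* Both composites are [xi_1 (b; f_i * xi_idm phi_i)]. *)
have hz i : src (k1 (z i)) = tgt (xi_idm (phi i)).
  by rewrite U_srcP xi_idm_tgt Et.
transitivity (xi1 (el (b : O1 n) (fun i => k1 (U_act (hi i))))).
  have h1 : src b = tgt (idm (src b)) by rewrite tgt_idm.
  have h2 i : src (idm (T (z i))) = tgt (k1 (U_act (hi i))).
    by rewrite src_idm (Ek i (hz i)) tgt_comp.
  rewrite (xi_compE h1 h2 (erefl _) (xi_kappaE _ _)); congr F1; congr el.
    exact: comp_idr (erefl _).
  by apply: funext => i; apply: comp_idl (erefl _).
have h1 : src (idm (tgt b)) = tgt b by rewrite src_idm.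
have ePhi : xi_idm Phi = xi1 (el (b : O1 n) (fun i => xi_idm (phi i))).
  by rewrite xi_idm_mu dmapE.
rewrite (xi_compE h1 hz (xi_kappaE _ _) ePhi); congr F1; congr el.
  exact: esym (comp_idl _ (erefl _)).
by apply: funext => i; apply: Ek.
Qed.

(** In the unit and associativity laws the elements of the fiber product are
    given by their two projections, which makes the laws independent of the
    proofs of compatibility. *)
Lemma U_unitl (p : U2) m :
  pfst p = U_id (T m) -> psnd p = deta O0 m -> U_comp p = m.
Proof.
move=> E1 E2; apply: U_eq; last first.
  by rewrite -[LHS]/(dmu (dmap S (psnd p))) E2 deta_nat dmu_deta.
have h : src (k1 (U_id (T m))) = tgt (xi_kappa (deta O0 m)).
  by rewrite xi_kappa_deta src_idm.
by rewrite (U_compE h E1 E2) (comp_idl h (erefl _)) xi_kappa_deta.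
Qed.

Lemma U_unitr (p : U2) m :
  pfst p = m -> psnd p = dmap (@U_id D HD C) (S m) -> U_comp p = m.
Proof.
move=> E1 E2; apply: U_eq; last first.
  by rewrite -[LHS]/(dmu (dmap S (psnd p))) E2 dmap_comp dmu_dmap_deta.
have h : src (k1 m) = tgt (xi_kappa (dmap (@U_id D HD C) (S m))).
  by rewrite xi_kappa_id tgt_idm U_srcP.
by rewrite (U_compE h E1 E2); apply: comp_idr (xi_kappa_id _).
Qed.

(** The operation [id_a] is idempotent, so by functoriality the composite of
    [xi_1 (id_a; f_i)] with [xi_1 (id_a; xi_kappa q_i)] is
    [xi_1 (id_a; f_i * xi_kappa q_i)]. *)
Lemma xi_kappa_comp (r : dmon O0 U2)
    (h : src (xi_kappa (dmap pfst r)) = tgt (xi_kappa (dmu (dmap psnd r)))) :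
  xi_kappa (dmap (@U_comp D HD C) r) = comp h.
Proof.
move: r h; apply: elP => n a x; rewrite !dmapE => h.
have h1 : src (idm (a : ob (D n))) = tgt (idm (a : ob (D n))).
  by rewrite src_idm tgt_idm.
have h2 i : src (k1 (pfst (x i))) = tgt (xi_kappa (psnd (x i))).
  exact: U_kappa2_subproof (x i).
have e2 : xi_kappa (dmu (el (a : O0 n) (psnd \o x)))
    = xi1 (el (idm (a : ob (D n)) : O1 n) (fun i => xi_kappa (psnd (x i)))).
  by rewrite xi_kappa_mu dmapE dnatE.
rewrite (xi_compE h1 h2 (xi_kappaE _ _) e2) xi_kappaE; congr F1; congr el.
  exact: esym (comp_idl _ (erefl _)).
by apply: funext => i; apply: U_compE.
Qed.

Lemma U_assoc (p : U3) (pT pS : U2) :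
  pfst pT = U_comp (pfst p) -> psnd pT = dmu (dmap psnd (psnd p)) ->
  pfst pS = pfst (pfst p) -> psnd pS = dmap (@U_comp D HD C) (psnd p) ->
  U_comp pT = U_comp pS.
Proof.
move=> ET1 ET2 ES1 ES2; apply: U_eq; last first.
  rewrite -[LHS]/(dmu (dmap S (psnd pT))) -[RHS]/(dmu (dmap S (psnd pS))).
  rewrite ET2 ES2 dmu_nat dmu_assoc !dmap_comp.
  by congr dmu; apply: dmap_ext => q.
have hT : src (k1 (U_comp (pfst p))) =
    tgt (xi_kappa (dmu (dmap psnd (psnd p)))).
  by rewrite -ET1 -ET2; exact: U_kappa2_subproof pT.
have hS : src (k1 (pfst (pfst p))) =
    tgt (xi_kappa (dmap (@U_comp D HD C) (psnd p))).
  by rewrite -ES1 -ES2; exact: U_kappa2_subproof pS.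
rewrite (U_compE hT ET1 ET2) (U_compE hS ES1 ES2).
have Ep : psnd (pfst p) = dmap pfst (psnd p) by exact: pullP p.
have hp : src (k1 (pfst (pfst p))) = tgt (xi_kappa (dmap pfst (psnd p))).
  by rewrite -Ep; exact: U_kappa2_subproof (pfst p).
have Ek := U_compE hp (erefl _) Ep.
have hr : src (xi_kappa (dmap pfst (psnd p))) =
    tgt (xi_kappa (dmu (dmap psnd (psnd p)))).
  by rewrite -(src_comp hp) -Ek.
have h1 : src (comp hp) = tgt (xi_kappa (dmu (dmap psnd (psnd p)))).
  by rewrite src_comp.
have h2 : src (k1 (pfst (pfst p))) = tgt (comp hr) by rewrite tgt_comp.
transitivity (comp h1); first exact: comp_eq.
rewrite -(compA h2); apply: comp_eq => //; exact: esym (xi_kappa_comp hr).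
Qed.

End Underlying.

Theorem mainTheorem3 (D : catOperad) (HD : sigma_free D) (C : algebra HD) :
  isMulticategory (underlying C).
Proof.
have SI (a : ob C) : U_src (U_id a) = deta (obOperad D) a by [].
have TI (a : ob C) : U_tgt (U_id a) = a by apply: tgt_idm.
have Tg (p : mc2 (underlying C)) : U_tgt (U_comp p) = U_tgt (pfst p).
  exact: tgt_comp.
have Sg (p : mc2 (underlying C)) :
    U_src (U_comp p) = dmu (dmap (@U_src D HD C) (psnd p)) by [].
refine (@IsMulticategory D HD (underlying C) (@U_isPresheaf D HD C)
  (@U_tgt_map D HD C) (@U_src_map D HD C) (@U_id_map D HD C)
  (@U_comp_map D HD C) SI TI Tg Sg _ _ _).
- by move=> m; apply: U_unitl.
- by move=> m; apply: U_unitr.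
- by move=> p; apply: (U_assoc (p := p)).
Qed.
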